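(* Let $d \geq 1$, and let $X$ be a $\mathbb{Z}^d$ subshift satisfying the periodic marker condition with parameters $m_n = n$. Let $\mathcal{A}_Y$ be a finite alphabet and let $\alpha_Y \in [0,1]$. If $\log(\alpha_Y|\mathcal{A}_Y|) > h(X)$, then there exists $\rho > 0$ such that for all large enough $n$, $$\mathbb{P}_{n,\alpha_Y}\bigl(X \text{ embeds into } Y\bigr) \geq 1 - e^{-\rho n^d},$$ where $Y = Y(\mathcal{F}) \subset \mathcal{A}_Y^{\mathbb{Z}^d}$ is the random $\mathbb{Z}^d$ SFT obtained from a random set $\mathcal{F}$ of forbidden patterns drawn according to $\mathbb{P}_{n,\alpha_Y}$.
   Context: Subshifts. For a finite set (alphabet) $\mathcal{A}$, the shift action on $\mathcal{A}^{\mathbb{Z}^d}$ (product topology) is $(\sigma_t x)(s) = x(s+t)$. A $\mathbb{Z}^d$ subshift is a closed shift-invariant subset of $\mathcal{A}^{\mathbb{Z}^d}$. Patterns (elements of $\mathcal{A}^S$, $S\subset\mathbb{Z}^d$) are considered up to translation. For finite $S \subset\mathbb{Z}^d$, $\mathcal{L}_S(X)$ is the set of patterns with shape $S$ that appear in points of $X$. Topological entropy: $h(X) = \lim_{n_1,\dots,n_d\to\infty} \frac{1}{\prod_{i=1}^d n_i}\log\bigl|\mathcal{L}_{\prod_{i=1}^d [1,n_i]}(X)\bigr|$ (intervals are in $\mathbb{Z}$). A factor map is a surjective continuous shift-commuting map between subshifts; an embedding is an injective continuous shift-commuting map from one $\mathbb{Z}^d$ subshift into another. $X$ embeds into $Y$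 if an embedding $X\to Y$ exists. Lattices. Distances are $\ell_\infty$: $d(u,v)=\|u-v\|_\infty$, and $\mathrm{dist}(p,E)=\inf_{q \in E} d(p,q)$. For $E\subset\mathbb{Z}^d$ and $r>0$, $\partial^{out}_r(E) = \{p \in \mathbb{Z}^d\setminus E : \mathrm{dist}(p,E)\leq r\}$. A lattice is a finite-index subgroup $\Lambda$ of $\mathbb{Z}^d$; $\mathrm{vol}(\Lambda)$ is its index in $\mathbb{Z}^d$. Given a basis $\{p_1,\dots,p_d\}$ of $\Lambda$, the associated fundamental domain is $P = \{\sum_{i=1}^d s_ip_i : s_i \in [0,1)\}\subset\mathbb{R}^d$. Regular sequences. Let $\{m_n\}_n$ be natural numbers with $m_n\geq n$ for all $n$. A sequence $\{\Lambda_n\}_n$ of lattices in $\mathbb{Z}^d$ is $\{m_n\}$-regular if there is a sequence of associated fundamental domains $\{P_n\}_n$ (each $P_n$ coming from some basis of $\Lambda_n$) such that (P1) $\lim_n \frac1n\log\mathrm{vol}(\Lambda_n) = 0$, and (P2) $\lim_n \frac{|\partial^{out}_{m_n}(P_n\cap\mathbb{Z}^d)|}{\mathrm{vol}(\Lambda_n)} = 0$. Periodic marker condition. If $\mathcal{O}$ is a finite shift orbit in $\mathcal{A}^{\mathbb{Z}^d}$ ($\mathcal A$ a finite alphabet), its associated lattice is the unique lattice $\Lambda$ with $\{p \in \mathbb{Z}^d : \sigma_p(x) = x\} = \Lambda$ for every $x \in \mathcal{O}$. A $\mathbb{Z}^d$ subshift $X$ satisfies the periodic marker condition with parameters $\{m_n\}_n$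 if there is a sequence of finite orbits $\{\mathcal{O}_n\}_n$ such that $X$ factors onto each $\mathcal{O}_n$ and the associated sequence of lattices $\{\Lambda_n\}_n$ is $\{m_n\}$-regular. Random SFTs: let $F_n = [0,n)^d \subset \mathbb{Z}^d$. For $\alpha \in [0,1]$ and $n \in \mathbb{N}$, $\mathbb{P}_{n,\alpha}$ is the probability measure on the power set of $\mathcal{A}^{F_n}$ given by $\mathbb{P}_{n,\alpha}(\{\mathcal{F}\}) = \alpha^{|\mathcal{A}|^{n^d} - |\mathcal{F}|}(1-\alpha)^{|\mathcal{F}|}$ for $\mathcal{F}\subset\mathcal{A}^{F_n}$ (each pattern is independently forbidden with probability $1-\alpha$). The random $\mathbb{Z}^d$ SFT associated to $\mathcal{F}$ is $\{x \in \mathcal{A}^{\mathbb{Z}^d} : \forall p \in \mathbb{Z}^d,\ \sigma_p(x)|_{F_n}\notin\mathcal{F}\}$. *)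

(* Defs.v *)
From HB Require Import structures.
From mathcomp Require Import all_boot all_order all_algebra finmap.
From mathcomp Require Import all_classical all_reals all_analysis.

Set Implicit Arguments.
Unset Strict Implicit.
Unset Printing Implicit Defensive.

Import Order.TTheory GRing.Theory Num.Theory.
Import numFieldNormedType.Exports.

Local Open Scope classical_set_scope.
Local Open Scope ring_scope.

(* Z^d; the norm `|p| that the library puts on it is the (int-valued) sup norm. *)
Notation zlattice d := 'rV[int]_d.

Notation config d A :=
  (prod_topology (fun _ : zlattice d => discrete_topology A)).

Definition shift d (A : finType) (t : zlattice d) (x : config d A) :
  config d A := fun s => x (s + t).

Definition subshift d (A : finType) (X : set (config d A)) : Prop :=
  closed X /\ forall t x, X x -> X (shift t x).

(* Maps between subshifts are represented by functions on the full
   configuration space, of which only the values on X matter. *)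
Definition shift_map d (A B : finType) (X : set (config d A))
    (Y : set (config d B)) (phi : config d A -> config d B) : Prop :=
  [/\ {within X, continuous phi},
      forall x, X x -> Y (phi x)
    & forall t x, X x -> phi (shift t x) = shift t (phi x)].

Definition factors_onto d (A B : finType) (X : set (config d A))
    (Y : set (config d B)) : Prop :=
  exists2 phi, shift_map X Y phi & set_surj X Y phi.

Definition embeds d (A B : finType) (X : set (config d A))
    (Y : set (config d B)) : Prop :=
  exists2 phi, shift_map X Y phi & set_inj X phi.

(* The box a + \prod_i [0, n_i) of Z^d. *)
Definition box d (a : zlattice d) (n : 'I_d -> nat) : {fset zlattice d} :=
  [fset (a + \row_i (k i : nat)%:Z)%R |
    k : {dffun forall i, 'I_(n i)} in predT]%fset.

Lemma in_box d (a : zlattice d) (n : 'I_d -> nat) (p : zlattice d) :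
  (p \in box a n) = [forall i, a ord0 i <= p ord0 i < a ord0 i + (n i)%:Z].
Proof.
apply/imfsetP/forallP => [[k _ ->] i|pan].
  by rewrite !mxE lerDl ltrD2l ltz_nat ltn_ord.
have kP i : (`|p ord0 i - a ord0 i| < n i)%N.
  by have /andP[ap pn] := pan i; rewrite -ltz_nat gez0_abs ?subr_ge0// ltrBlDl.
exists [ffun i => Ordinal (kP i)] => //.
apply/rowP => i; rewrite !mxE ffunE/=.
by have /andP[ap _] := pan i; rewrite gez0_abs ?subr_ge0// addrC subrK.
Qed.

Definition restrict d (A : finType) (S : {fset zlattice d}) (x : config d A) :
  {ffun S -> A} := [ffun s : S => x (val s)].

(* Patterns are considered up to translation, whence the shift. *)
Definition language d (A : finType) (S : {fset zlattice d})
    (X : set (config d A)) : {set {ffun S -> A}} :=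
  [set w | `[< exists2 x, X x & exists p, restrict S (shift p x) = w >]].

(* n_1, ..., n_d -> oo independently of each other. *)
Definition all_infty (d : nat) : set_system ('I_d -> nat) :=
  filter_from [set: nat] (fun N => [set n | forall i, (N <= n i)%N]).
Arguments all_infty d : clear implicits.

(* Extended-real valued, so that h(set0) = -oo; the box below is
   \prod_i [1, n_i]. *)
Definition entropy (R : realType) d (A : finType) (X : set (config d A)) :
    \bar R :=
  lim ((fun n : 'I_d -> nat =>
    ((\prod_i (n i)%:R)^-1)%:E *
    lne (#|language (box (const_mx 1) n) X|%:R)%:E)%E @ all_infty d).

Definition cosets d (L : set (zlattice d)) : set (set (zlattice d)) :=
  range (fun p : zlattice d => [set q | L (q - p)]).

Definition lattice d (L : set (zlattice d)) : Prop :=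
  [/\ L 0, forall p q, L p -> L q -> L (p - q) & finite_set (cosets L)].

Definition vol d (L : set (zlattice d)) : nat := #|` fset_set (cosets L)|%fset.

Definition lattice_basis d (L : set (zlattice d)) (p : 'I_d -> zlattice d) :
    Prop :=
  set_bij [set: zlattice d] L (fun c => \sum_i p i *~ c ord0 i).

Definition real_point (R : realType) d (p : zlattice d) : 'rV[R]_d :=
  map_mx intr p.

Definition fundamental_domain (R : realType) d (p : 'I_d -> zlattice d) :
    set 'rV[R]_d :=
  [set v | exists2 s : 'I_d -> R, forall i, 0 <= s i < 1 &
           v = \sum_i s i *: real_point R (p i)].
Arguments fundamental_domain R {d} p.

Definition integer_points (R : realType) d (P : set 'rV[R]_d) :
    set (zlattice d) := [set p | P (real_point R p)].

Definition dist_to (R : realType) d (p : zlattice d) (E : set (zlattice d)) :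
    \bar R :=
  ereal_inf [set ((`|p - q| : int)%:~R : R)%:E | q in E].

Definition outer_boundary (R : realType) d (r : R) (E : set (zlattice d)) :
    set (zlattice d) := [set p | ~ E p /\ (dist_to R p E <= r%:E)%E].

(* The outer boundary of a finite set is finite, so fset_set is not applied
   to an infinite set (where it would return the empty set). *)
Definition regular (R : realType) d (m : nat -> nat)
    (L : nat -> set (zlattice d)) : Prop :=
  [/\ forall n, (n <= m n)%N,
      forall n, lattice (L n)
    & exists2 p : nat -> 'I_d -> zlattice d,
        forall n, lattice_basis (L n) (p n) &
        let P n := fundamental_domain R (p n) in
        (n%:R^-1 * ln ((vol (L n))%:R : R) @[n --> \oo] --> (0 : R)) /\
        ((#|` fset_set (outer_boundary ((m n)%:R : R)
                          (integer_points (P n)))|%fset%:R : R) /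
         (vol (L n))%:R @[n --> \oo] --> (0 : R))].

Definition finite_orbit d (A : finType) (O : set (config d A)) : Prop :=
  finite_set O /\ exists x, O = range (fun t => shift t x).

Definition associated_lattice d (A : finType) (O : set (config d A))
    (L : set (zlattice d)) : Prop :=
  forall x, O x -> [set p | shift p x = x] = L.

Definition periodic_marker (R : realType) d (A : finType)
    (X : set (config d A)) (m : nat -> nat) : Prop :=
  exists (B : nat -> finType) (O : forall n, set (config d (B n)))
         (L : nat -> set (zlattice d)),
    [/\ forall n, finite_orbit (O n),
        forall n, factors_onto X (O n),
        forall n, associated_lattice (O n) (L n)
      & regular R m L].

Definition cube (d n : nat) : {fset zlattice d} := box 0 (fun=> n).

Definition pattern (d n : nat) (A : finType) : finType :=
  {ffun cube d n -> A}.

Definition random_pmf (R : realType) d n (A : finType) (alpha : R)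
    (F : {set pattern d n A}) : R :=
  alpha ^+ (#|A| ^ (n ^ d) - #|F|) * (1 - alpha) ^+ #|F|.

Definition random_prob (R : realType) d n (A : finType) (alpha : R)
    (E : set {set pattern d n A}) : R :=
  \sum_(F in E) random_pmf alpha F.

Lemma card_pattern d n (A : finType) :
  #|{: pattern d n A}| = (#|A| ^ (n ^ d))%N.
Proof.
rewrite card_ffun -cardfE; congr (_ ^ _)%N.
rewrite card_imfset /=; last first.
  move=> k l /addrI/rowP kl; apply/ffunP => i; apply/val_inj.
  by have := kl i; rewrite !mxE => -[].
rewrite -cardE card_dep_ffun foldrE big_map big_enum /=.
under eq_bigr do rewrite card_ord.
by rewrite prod_nat_const card_ord.
Qed.

Lemma random_prob_setT (R : realType) d n (A : finType) (alpha : R) :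
  random_prob alpha [set: {set pattern d n A}] = 1.
Proof.
rewrite /random_prob /random_pmf -card_pattern.
set N := #|{: pattern d n A}|.
transitivity ((alpha + (1 - alpha)) ^+ N); last by rewrite subrKC expr1n.
rewrite exprDn (eq_bigl xpredT); last by move=> F; rewrite in_setT.
have le_N (F : {set pattern d n A}) : (#|F| < N.+1)%N by rewrite ltnS max_card.
rewrite (partition_big (fun F => Ordinal (le_N F)) xpredT)//=.
apply: eq_bigr => i _.
rewrite (eq_bigr (fun=> alpha ^+ (N - i) * (1 - alpha) ^+ i)); last first.
  by move=> F /eqP <-.
rewrite sumr_const; congr (_ *+ _).
rewrite -(card_draws (pattern d n A) i) cardsE.
by apply: eq_card => F.
Qed.

Definition random_sft d n (A : finType) (F : {set pattern d n A}) :
    set (config d A) :=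
  [set x | forall p : zlattice d, restrict (cube d n) (shift p x) \notin F].

(* Main.v *)
Require Import Defs.
From mathcomp Require Import all_boot all_order all_algebra.
From mathcomp Require Import ring lra zify.

(** Write beta for the product of alphaY and the number of letters of AY, so that
h(X) < ln beta. Let L be the n-th lattice of the marker condition and T the set
of integer points of its fundamental domain. A function on T is read as an
L-periodic configuration; it is called aperiodic if its windows of side n at the
points of T are pairwise different.

Most functions on T are aperiodic, because T has only e^(o(n)) points
([card_common_window], [card_aperiodic_words]). Such a word avoids the random set
of forbidden patterns with probability alphaY to the power #|T|, so on average
about beta to the power #|T| of them survive. Two words are correlated only
through common windows. If a word repeats windows of another one at a set K of
positions, then K is covered by few cubes: n times their number is at most twice
the size of their union ([thin_segment_cover]). On this union the word is
determined by the places in the other word that it repeats, and the choice of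
these places among e^(o(n)) costs less than the determined letters gain
([sum_shared_windows]). Thus the variance is smaller than the square of the mean
by a factor exponential in n^d. By Chebyshev's inequality, at least a quarter of
beta to the power #|T| aperiodic words survive, outside of an event of
probability at most e^(- rho n^d) ([few_surviving_words_rare]).

The frame of T is the set of its points within distance n of the complement. It
has o(#|T|) points by regularity ([card_frame_le]), so some filling of the frame
extends to e^((ln beta - o(1)) #|T|) surviving words. On the other hand, for some
constant c < ln beta, the patterns of shape T in X are fewer than e^(c #|T|) when
n is large ([entropy_lt_box], [log_complexity_tiling]). So these patterns can be
coded injectively by surviving words that agree on the frame. The factor map onto
the n-th orbit attaches to each x in X an L-periodic tiling by translates of T.
Filling each tile with the code of the pattern of x on it defines a continuous
map that commutes with the shifts ([tile_coding]). Where a window of the image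
passes from one tile to another it sees only frame points, so it is a window of a
surviving word ([glue_window]) and the image lies in Y. A window that consists of
frame points occurs in the image at one class of positions modulo L only, because
the words are aperiodic ([glue_marker]). So the image determines the tiling, then
the pattern of x on each tile, and the map is injective. *)

Set Implicit Arguments.
Unset Strict Implicit.
Unset Printing Implicit Defensive.

Import Order.TTheory GRing.Theory Num.Theory.

Local Open Scope ring_scope.

(** * The second moment of the number of surviving words *)

Section SecondMoment.
Variables (R : realFieldType) (P J : finType) (alpha : R).
Hypothesis halpha : 0 < alpha <= 1.

Definition bernoulli_weight (F : {set P}) : R :=
  alpha ^+ (#|P| - #|F|) * (1 - alpha) ^+ #|F|.

Lemma bernoulli_weight_ge0 F : 0 <= bernoulli_weight F.
Proof.
by case/andP: halpha => a0 a1; rewrite mulr_ge0 ?exprn_ge0 ?subr_ge0 ?(ltW a0).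
Qed.

Lemma bernoulli_weightE F :
  bernoulli_weight F = \prod_p (if p \in F then 1 - alpha else alpha).
Proof.
rewrite (bigID (mem F)) /= mulrC /bernoulli_weight; congr (_ * _).
  rewrite (eq_bigr (fun=> alpha)); last by move=> p /negbTE->.
  by rewrite prodr_const; congr (_ ^+ _); rewrite -(cardC (mem F)) addKn.
by rewrite (eq_bigr (fun=> 1 - alpha)) ?prodr_const// => p ->.
Qed.

Lemma sum_bernoulli_weight_disjoint (W : {set P}) :
  \sum_(F | F :&: W == set0) bernoulli_weight F = alpha ^+ #|W|.
Proof.
transitivity (\sum_(F : {set P})
    \prod_p (if p \in F then if p \in W then 0 else 1 - alpha else alpha)).
  rewrite big_mkcond; apply: eq_bigr => F _; case: ifPn => [/eqP FW|].
    rewrite bernoulli_weightE; apply: eq_bigr => p _.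
    case: ifPn => // pF; case: ifPn => // pW.
    by have := in_set0 p; rewrite -FW inE pF pW.
  case/set0Pn => p; rewrite inE => /andP[pF pW].
  by rewrite (bigD1 p) //= pF pW mul0r.
rewrite -bigA_distr.
rewrite (bigID (mem W)) /= [X in _ * X]big1 ?mulr1; last first.
  by move=> p /negbTE->; rewrite subrK.
by rewrite -prodr_const; apply: eq_bigr => p ->; rewrite add0r.
Qed.

Variables (G : {set J}) (V : J -> {set P}) (v : nat).
Hypothesis cardV : forall w, w \in G -> #|V w| = v.

Let Z (F : {set P}) : R := #|[set w in G | F :&: V w == set0]|%:R.
Let mu : R := #|G|%:R * alpha ^+ v.

Let ZE F : Z F = \sum_(w in G) (F :&: V w == set0)%:R.
Proof.
rewrite /Z -sum1_card natr_sum [LHS]big_mkcond [RHS]big_mkcond /=.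
by apply: eq_bigr => w _; rewrite inE; case: (w \in G); case: (_ == _).
Qed.

Let expectation (W : {set P}) :
  \sum_F bernoulli_weight F * (F :&: W == set0)%:R = alpha ^+ #|W|.
Proof.
rewrite -sum_bernoulli_weight_disjoint [RHS]big_mkcond; apply: eq_bigr => F _.
by case: (_ == _); rewrite ?mulr1 ?mulr0.
Qed.

Let total : \sum_F bernoulli_weight F = 1.
Proof.
rewrite -(expr0 alpha) -(cards0 P) -(expectation set0).
by apply: eq_bigr => F _; rewrite setI0 eqxx mulr1.
Qed.

Let EZ : \sum_F bernoulli_weight F * Z F = mu.
Proof.
under eq_bigr do rewrite ZE mulr_sumr.
rewrite exchange_big /= /mu mulr_natl -sumr_const; apply: eq_bigr => w wG.
by rewrite expectation cardV.
Qed.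

Let disjointU (F A B : {set P}) :
  (F :&: (A :|: B) == set0) = (F :&: A == set0) && (F :&: B == set0).
Proof. by rewrite setIUr setU_eq0. Qed.

Let EZ2 : \sum_F bernoulli_weight F * Z F ^+ 2 =
  \sum_(w in G) \sum_(w' in G) alpha ^+ #|V w :|: V w'|.
Proof.
under eq_bigr => F _.
  rewrite ZE expr2 mulr_suml mulr_sumr.
  under eq_bigr => w _.
    rewrite mulr_sumr mulr_sumr.
    under eq_bigr => w' _ do rewrite -natrM mulnb -disjointU.
    over.
  over.
rewrite exchange_big /=; apply: eq_bigr => w _.
by rewrite exchange_big /=; apply: eq_bigr => w' _; rewrite expectation.
Qed.

Let variance : \sum_F bernoulli_weight F * (Z F - mu) ^+ 2 <=
  alpha ^+ (2 * v) * \sum_(w in G) \sum_(w' in G | V w :&: V w' != set0)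
      alpha ^- #|V w :&: V w'|.
Proof.
have a0 : 0 < alpha by case/andP: halpha.
have -> : \sum_F bernoulli_weight F * (Z F - mu) ^+ 2 =
    \sum_F bernoulli_weight F * Z F ^+ 2 - mu ^+ 2.
  under eq_bigr => F _.
    rewrite (_ : _ * _ = bernoulli_weight F * Z F ^+ 2 +
      (- 2 * mu) * (bernoulli_weight F * Z F) + mu ^+ 2 * bernoulli_weight F);
      last by ring.
    over.
  by rewrite !big_split /= -!mulr_sumr EZ total; ring.
rewrite EZ2 lerBlDl {1}/mu exprMn -exprM mulnC.
rewrite -natrX expnS expn1 natrM -mulrA mulr_natl -sumr_const.
rewrite mulr_sumr -big_split /=; apply: ler_sum => w wG.
rewrite mulr_natl -sumr_const mulr_sumr [X in _ <= _ + X]big_mkcondr -big_split.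
apply: ler_sum => w' w'G /=.
have cU : (#|V w :|: V w'| + #|V w :&: V w'| = 2 * v)%N.
  by rewrite cardsUI !cardV// mulSn mul1n.
case: eqVneq => [VV0|_]; first by rewrite -cU VV0 cards0 addn0 addr0.
rewrite -cU exprD mulfK ?expf_neq0 ?gt_eqF// lerDr mulr_ge0// exprn_ge0//.
all: exact: ltW.
Qed.

(** Chebyshev's inequality. The events that [V w] and [V w'] avoid the random
set are independent when these two sets are disjoint, so only pairs that meet
contribute to the variance; for such a pair the joint probability is the product
of the two probabilities times [alpha ^- #|V w :&: V w'|]. *)
Lemma second_moment : (0 < #|G|)%N ->
  \sum_(F | #|[set w in G | F :&: V w == set0]|%:R
              < #|G|%:R * alpha ^+ v / 2) bernoulli_weight F <=
  4 / #|G|%:R ^+ 2 * \sum_(w in G) \sum_(w' in G | V w :&: V w' != set0)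
      alpha ^- #|V w :&: V w'|.
Proof.
move=> G0; have a0 : 0 < alpha by case/andP: halpha.
have mu0 : 0 < mu by rewrite mulr_gt0 ?exprn_gt0 ?ltr0n.
have mu2 : 0 < (mu / 2) ^+ 2 by rewrite exprn_gt0 ?divr_gt0.
rewrite -(ler_pM2l mu2) mulr_sumr.
apply: (@le_trans _ _ (\sum_F bernoulli_weight F * (Z F - mu) ^+ 2)).
  rewrite big_mkcond; apply: ler_sum => F _.
  have w0 := bernoulli_weight_ge0 F.
  case: ifPn => [Zlt|_]; last by rewrite mulr_ge0 ?sqr_ge0.
  rewrite mulrC ler_wpM2l// -[leRHS]sqrrN opprB lerXn2r ?nnegrE//.
  - by rewrite divr_ge0 // ltW.
  - by move: Zlt; rewrite -/(Z F) -/mu; lra.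
  - by move: Zlt; rewrite -/(Z F) -/mu; lra.
apply: le_trans variance _; rewrite mulrA le_eqVlt; apply/orP; left; apply/eqP.
congr (_ * _); rewrite /mu mulnC exprM.
by field; rewrite pnatr_eq0 -lt0n.
Qed.

End SecondMoment.

(** * Words on a finite set of positions and their windows *)

Lemma card_determined (I B : finType) (E : {set {ffun I -> B}}) (D : {set I}) :
  {in E &, forall w1 w2 : {ffun I -> B}, {in ~: D, w1 =1 w2} -> w1 = w2} ->
  (#|E| <= #|B| ^ (#|I| - #|D|))%N.
Proof.
move=> detE.
pose f (w : {ffun I -> B}) : {ffun {i | i \in ~: D} -> B} :=
  [ffun i => w (val i)].
have f_inj : {in E &, injective f}.
  move=> w1 w2 w1E w2E /ffunP eqf; apply: detE => // i iD.
  by have := eqf (exist _ i iD); rewrite !ffunE.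
rewrite -(card_in_imset f_inj) (leq_trans (max_card _))// card_ffun card_sig.
rewrite -(cardsC D) addKn; apply/eq_leq; congr (_ ^ _)%N.
Qed.

Section SegmentCover.
Variables (I : finType) (sigma : I -> I) (n : nat).
Hypothesis sigma_inj : injective sigma.

Definition segment (k : I) : {set I} := [set iter (val j) sigma k | j : 'I_n].

Lemma segmentP k x :
  reflect (exists2 j, (j < n)%N & x = iter j sigma k) (x \in segment k).
Proof.
apply: (iffP imsetP) => [[j _ ->]|[j jn ->]]; first by exists j.
by exists (Ordinal jn).
Qed.

Let iter_sigma_inj j : injective (iter j sigma).
Proof. by elim: j => [|j IH] //= x y /sigma_inj/IH. Qed.

(* Of three segments through x, the one that starts in the middle is
   redundant: together the other two reach at least as far on both sides. *)
Let segment_between x k1 k2 k3 a1 a2 a3 : (a1 < a2 < a3)%N -> (a3 < n)%N ->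
  x = iter a1 sigma k1 -> x = iter a2 sigma k2 -> x = iter a3 sigma k3 ->
  segment k2 \subset segment k1 :|: segment k3.
Proof.
case/andP=> a12 a23 a3n x1 x2 x3.
have k23 : k2 = iter (a3 - a2) sigma k3.
  by apply: (@iter_sigma_inj a2); rewrite -iterD subnKC -?x2// ltnW.
have k12 : k1 = iter (a2 - a1) sigma k2.
  by apply: (@iter_sigma_inj a1); rewrite -iterD subnKC -?x1// ltnW.
apply/subsetP => _ /segmentP[j jn ->]; rewrite inE.
have [jlt|jge] := ltnP (j + (a3 - a2)) n.
  by apply/orP; right; apply/segmentP; exists (j + (a3 - a2))%N => //; rewrite k23 iterD.
apply/orP; left; apply/segmentP; exists (j - (a2 - a1))%N; first by lia.
by rewrite k12 -iterD; congr (iter _ _ _); lia.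
Qed.

(** A cover of [K] by segments that is minimal for inclusion meets no point more
than twice, since of three segments through a point one is redundant. Hence the
lengths of its segments add up to at most twice the size of their union. *)
Lemma thin_segment_cover (K : {set I}) : (0 < n)%N ->
  (forall k, #|segment k| = n) ->
  exists2 K0 : {set I}, K0 \subset K &
    K \subset \bigcup_(k in K0) segment k /\
    (n * #|K0| <= 2 * #|\bigcup_(k in K0) segment k|)%N.
Proof.
move=> n_gt0 card_seg.
pose covers (K0 : {set I}) :=
  (K0 \subset K) && (K \subset \bigcup_(k in K0) segment k).
have coversK : covers K.
  rewrite /covers subxx /=; apply/subsetP => k kK; apply/bigcupP; exists k => //.
  by apply/segmentP; exists 0%N.
have [K0 /minsetP[/andP[K0K KK0] minK0] _] := minset_exists coversK.
exists K0 => //; split=> //.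
have irredundant k1 k2 k3 : k1 \in K0 -> k2 \in K0 -> k3 \in K0 ->
    k1 != k2 -> k3 != k2 -> segment k2 \subset segment k1 :|: segment k3 -> False.
  move=> k1K k2K k3K k12 k32 /subsetP sub.
  suff coversD : covers (K0 :\ k2).
    by have := minK0 _ coversD (subD1set _ _); move/setP/(_ k2); rewrite !inE eqxx k2K.
  rewrite /covers (subset_trans (subD1set _ _) K0K) /=.
  apply: (subset_trans KK0); apply/bigcupsP => k kK0.
  have [->|kk2] := eqVneq k k2; last by apply: bigcup_sup; rewrite !inE kk2.
  apply/subsetP => x /sub; rewrite inE => /orP[xk|xk]; apply/bigcupP.
    by exists k1 => //; rewrite !inE k12.
  by exists k3 => //; rewrite !inE k32.
have mult x : (#|[set k in K0 | x \in segment k]| <= 2)%N.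
  rewrite leqNgt; apply/negP => /card_gt2P[k1 [k2 [k3 [[]]]]].
  rewrite !inE => /andP[k1K /segmentP[a1 a1n x1]] /andP[k2K /segmentP[a2 a2n x2]].
  move=> /andP[k3K /segmentP[a3 a3n x3]] [k12 k23 k31].
  have neqa k k' a a' : x = iter a sigma k -> x = iter a' sigma k' ->
      k != k' -> a != a'.
    move=> xk xk'; apply: contra_neq => aa'; apply: (@iter_sigma_inj a).
    by rewrite -xk xk' aa'.
  have a12 := neqa _ _ _ _ x1 x2 k12.
  have a23 := neqa _ _ _ _ x2 x3 k23.
  have a31 := neqa _ _ _ _ x3 x1 k31.
  have between := segment_between.
  have [k21 k32 k13] : [/\ k2 != k1, k3 != k2 & k1 != k3].
    by split; rewrite eq_sym.
  have : [|| a1 < a2 < a3, a1 < a3 < a2, a2 < a1 < a3, a2 < a3 < a1,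
             a3 < a1 < a2 | a3 < a2 < a1]%N by lia.
  case/or4P => [a|a|a|/or3P[]a].
  - exact: (irredundant k1 k2 k3 _ _ _ _ _ (between _ _ _ _ _ _ _ a a3n x1 x2 x3)).
  - exact: (irredundant k1 k3 k2 _ _ _ _ _ (between _ _ _ _ _ _ _ a a2n x1 x3 x2)).
  - exact: (irredundant k2 k1 k3 _ _ _ _ _ (between _ _ _ _ _ _ _ a a3n x2 x1 x3)).
  - exact: (irredundant k2 k3 k1 _ _ _ _ _ (between _ _ _ _ _ _ _ a a1n x2 x3 x1)).
  - exact: (irredundant k3 k1 k2 _ _ _ _ _ (between _ _ _ _ _ _ _ a a2n x3 x1 x2)).
  - exact: (irredundant k3 k2 k1 _ _ _ _ _ (between _ _ _ _ _ _ _ a a1n x3 x2 x1)).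
set U := \bigcup_(k in K0) _.
have -> : (n * #|K0| = \sum_(k in K0) \sum_(x in U) (x \in segment k))%N.
  rewrite mulnC -sum_nat_const; apply: eq_bigr => k kK0.
  rewrite -(card_seg k) -sum1_card [LHS]big_mkcond [RHS]big_mkcond /=.
  apply: eq_bigr => x _; have [xk|_] := boolP (x \in segment k).
    by rewrite (subsetP (bigcup_sup k kK0) x xk).
  by case: ifP.
rewrite exchange_big /= mulnC -sum_nat_const leq_sum// => x _.
rewrite (leq_trans _ (mult x))// -sum1_card [leqLHS]big_mkcond [leqRHS]big_mkcond.
by apply: leq_sum => k _; rewrite inE; case: (k \in K0); case: (x \in _).
Qed.

End SegmentCover.

Section Windows.
Variables (I S B : finType) (add : I -> S -> I).

(** [add q s] is the position seen at place [s] of the window placed at [q]. *)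
Definition window (w : {ffun I -> B}) (q : I) : {ffun S -> B} :=
  [ffun s => w (add q s)].

Definition windows (w : {ffun I -> B}) : {set {ffun S -> B}} :=
  [set window w q | q in I].

Definition covered (K : {set I}) : {set I} :=
  \bigcup_(q in K) [set add q s | s in S].

Definition aperiodic_words : {set {ffun I -> B}} :=
  [set w | injectiveb (window w)].

Lemma aperiodic_wordsP w : reflect (injective (window w)) (w \in aperiodic_words).
Proof. by rewrite inE; apply: injectiveP. Qed.

Lemma card_windows w : w \in aperiodic_words -> #|windows w| = #|I|.
Proof. by move/aperiodic_wordsP => inj; rewrite card_imset. Qed.

(** The union bound over the pairs of distinct positions. *)
Lemma card_aperiodic_words (N : nat) :
  (forall q q', q != q' -> #|[set w | window w q == window w q']| <= N)%N ->
  (#|B| ^ #|I| <= #|aperiodic_words| + #|I| ^ 2 * N)%N.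
Proof.
move=> bound; rewrite -card_ffun -(cardsC aperiodic_words) leq_add2l.
apply: (@leq_trans #|\bigcup_(qq : I * I | qq.1 != qq.2)
                  [set w | window w qq.1 == window w qq.2]|).
  apply/subset_leq_card/subsetP => w; rewrite !inE => /injectivePn[q [q' qq' e]].
  by apply/bigcupP; exists (q, q'); rewrite ?inE ?e.
apply: (@leq_trans (\sum_(qq : I * I | qq.1 != qq.2)
    #|[set w | window w qq.1 == window w qq.2]|)).
  elim/big_rec2: _ => [|qq n E _ le]; first by rewrite cards0.
  by rewrite (leq_trans (leq_card_setU _ _))// leq_add2l.
rewrite expnS expn1 -card_prod -sum_nat_const big_mkcond /= leq_sum// => qq _.
by case: ifP => // /bound.
Qed.

Hypothesis add_inj : forall q, injective (add q).
Variables (R : realFieldType) (alpha gam : R) (n : nat).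
Hypotheses (halpha : 0 < alpha <= 1) (hgam : 1 <= gam)
  (hbeta : alpha * #|B|%:R = gam ^+ 4).
Hypothesis thin_cover : forall K : {set I}, exists2 K0 : {set I},
  K0 \subset K & K \subset covered K0 /\ (n * #|K0| <= 2 * #|covered K0|)%N.

(* The fourth root gam of beta = alpha * #|B| lets the gain beta ^- u from a
   covered set of size u be split evenly: u is at least #|S|, and at least n / 2
   times the number of windows in a thin cover. *)
Section FixedWord.
Variable w : {ffun I -> B}.

Let shared (w' : {ffun I -> B}) : {set I} := [set q | window w' q \in windows w].

Let dom (g : {ffun I -> option I}) : {set I} := [set q | isSome (g q)].

(* The words whose window at q repeats the window of w at q' when g q = Some q'. *)
Let copies (g : {ffun I -> option I}) : {set {ffun I -> B}} :=
  [set w' | [forall q, forall q', (g q == Some q') ==> (window w' q == window w q')]].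

Let card_copies g : (#|copies g| <= #|B| ^ (#|I| - #|covered (dom g)|))%N.
Proof.
apply: card_determined => w1 w2 w1g w2g eqw; apply/ffunP => i.
have [|iD] := boolP (i \in covered (dom g)); last by apply: eqw; rewrite inE.
case/bigcupP => q; rewrite inE; case gq: (g q) => [q'|//] _ /imsetP[s _ ->].
have agree w' : w' \in copies g -> w' (add q s) = w (add q' s).
  rewrite inE => /forallP/(_ q)/forallP/(_ q'); rewrite gq eqxx /= => /eqP/ffunP.
  by move/(_ s); rewrite !ffunE.
by rewrite !agree.
Qed.

Let copies_cover w' : shared w' != set0 -> exists g,
  [/\ w' \in copies g, dom g != set0, (n * #|dom g| <= 2 * #|covered (dom g)|)%N
    & (#|shared w'| <= #|covered (dom g)|)%N].
Proof.
move=> sh0; have [K0 K0s [sK0 card_K0]] := thin_cover (shared w').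
pose g := [ffun q => if q \in K0 then [pick q' | window w' q == window w q'] else None].
have domg : dom g = K0.
  apply/setP => q; rewrite !inE ffunE; case: ifPn => // qK0.
  case: pickP => // no; have := subsetP K0s q qK0; rewrite inE => /imsetP[q' _ e].
  by have := no q'; rewrite e eqxx.
exists g; rewrite domg; split=> //.
- rewrite inE; apply/forallP => q; apply/forallP => q'; apply/implyP.
  by rewrite ffunE; case: ifP => // _; case: pickP => // q2 /eqP-> /eqP[->].
- apply: contra_neq sh0 => K00; apply/eqP; rewrite -subset0.
  by rewrite (subset_trans sK0)// K00 /covered big_set0.
- exact: subset_leq_card.
Qed.

Let card_covered (K : {set I}) : K != set0 -> (#|S| <= #|covered K|)%N.
Proof.
case/set0Pn => q qK; rewrite -(card_imset _ (add_inj (q := q))).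
exact/subset_leq_card/(bigcup_sup q).
Qed.

(** A word [w'] that shares windows with [w] does so on a set of positions which
has a thin cover [K0]. Recording for each window in [K0] which window of [w] it
repeats gives a partial map [g], and [g] determines [w'] on the covered set, of
size [u] say. So [g] accounts for at most [#|B| ^ (#|I| - u)] words, each with
weight at most [alpha ^- u]. Summed over all [g], the product over the positions
of [1 + #|I| * gam ^- n] counts, at each position, either no choice or one of
[#|I|] values at the price [gam ^- n]. *)
Lemma sum_shared_windows :
  \sum_(w' | shared w' != set0) alpha ^- #|shared w'| <=
  #|B|%:R ^+ #|I| * gam ^- (2 * #|S|) * (1 + #|I|%:R * gam ^- n) ^+ #|I|.
Proof.
have a0 : 0 < alpha by case/andP: halpha.
have g0 : 0 < gam by apply: lt_le_trans hgam.
have le_alpha a b : (a <= b)%N -> alpha ^- a <= alpha ^- b.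
  move=> ab; rewrite lef_pV2 ?posrE ?exprn_gt0//.
  by rewrite ler_wiXn2l ?(ltW a0)//; case/andP: halpha.
have le_gam a b : (a <= b)%N -> gam ^- b <= gam ^- a.
  by move=> ab; rewrite lef_pV2 ?posrE ?exprn_gt0// ler_weXn2l.
pose good g := (dom g != set0) && (n * #|dom g| <= 2 * #|covered (dom g)|)%N.
apply: (@le_trans _ _ (\sum_(g | good g) \sum_(w' in copies g)
    alpha ^- #|covered (dom g)|)).
  rewrite (exchange_big_dep xpredT) //= big_mkcond; apply: ler_sum => w' _.
  case: ifPn => [/copies_cover[g [w'g g1 g2 le]]|_]; last first.
    by apply: sumr_ge0 => g _; rewrite invr_ge0 exprn_ge0 ?ltW.
  rewrite (bigD1 g) /= ?w'g ?andbT; last by rewrite /good g1.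
  rewrite -[leLHS]addr0 lerD ?le_alpha//.
  by apply: sumr_ge0 => ? _; rewrite invr_ge0 exprn_ge0 ?ltW.
have bound g : good g -> \sum_(w' in copies g) alpha ^- #|covered (dom g)| <=
    #|B|%:R ^+ #|I| * gam ^- (2 * #|S|) * \prod_q (if g q then gam ^- n else 1).
  case/andP => g1 g2; rewrite sumr_const -[leLHS]mulr_natl.
  set u := #|covered (dom g)|; have uI : (u <= #|I|)%N by apply: max_card.
  apply: (@le_trans _ _ (#|B|%:R ^+ (#|I| - u) * alpha ^- u)).
    rewrite ler_wpM2r ?invr_ge0 ?exprn_ge0 ?(ltW a0)//.
    by rewrite -natrX ler_nat card_copies.
  have -> : \prod_q (if g q then gam ^- n else 1) = gam ^- (n * #|dom g|).
    rewrite -big_mkcond /= prodr_const exprM exprVn.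
    by congr (_ ^- _); apply: eq_card => q; rewrite !inE.
  have B0 : (#|B|%:R : R) != 0.
    by apply: contraTneq (exprn_gt0 4 g0) => B0; rewrite -hbeta B0 mulr0 ltxx.
  have -> : #|B|%:R ^+ (#|I| - u) * alpha ^- u = #|B|%:R ^+ #|I| * gam ^- (4 * u).
    rewrite -[in RHS](subnK uI) [in RHS]exprD exprM -hbeta exprMn invfM.
    by rewrite mulrACA mulfV ?mulr1 ?expf_neq0.
  rewrite -mulrA ler_wpM2l ?exprn_ge0// -invfM -exprD; apply: le_gam.
  by have := card_covered g1; lia.
apply: le_trans (ler_sum _ bound) _.
rewrite -mulr_sumr ler_wpM2l ?mulr_ge0 ?invr_ge0 ?exprn_ge0 ?(ltW g0)//.
apply: (@le_trans _ _ (\sum_(g : {ffun I -> option I})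
    \prod_q (if g q then gam ^- n else 1))).
  rewrite [leLHS]big_mkcond; apply: ler_sum => g _; case: ifP => // _.
  by apply: prodr_ge0 => q _; case: ifP; rewrite ?invr_ge0 ?exprn_ge0 ?(ltW g0).
rewrite -(bigA_distr_bigA (fun (_ : I) (o : option I) => if o then gam ^- n else 1)).
rewrite prodr_const le_eqVlt; apply/orP; left; apply/eqP; congr (_ ^+ _).
rewrite (bigD1 None) //=; congr (_ + _).
rewrite (eq_bigr (fun=> gam ^- n)); last by case.
rewrite sumr_const -[LHS]mulr_natl; congr (_%:R * _).
have Some_inj : injective (@Some I) by move=> ? ? [].
rewrite -[RHS](card_imset predT Some_inj); apply: eq_card => -[q|].
  by rewrite [LHS]unfold_in; apply/esym/imsetP; exists q.
by rewrite [LHS]unfold_in; apply/esym/imsetP => -[].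
Qed.

End FixedWord.

(** For aperiodic [w] and [w'] the number of common windows is the number of
positions at which [w'] repeats a window of [w], so the variance is bounded by
the sums over [w'] for each fixed [w]. *)
Lemma few_surviving_words_rare : (0 < #|B|)%N ->
  (#|B| ^ #|I| <= 2 * #|aperiodic_words|)%N ->
  \sum_(F | #|[set w in aperiodic_words | F :&: windows w == set0]|%:R
      < #|aperiodic_words|%:R * alpha ^+ #|I| / 2) bernoulli_weight alpha F <=
  8 * gam ^- (2 * #|S|) * (1 + #|I|%:R * gam ^- n) ^+ #|I|.
Proof.
move=> B0 half; have a0 : 0 < alpha by case/andP: halpha.
have g0 : 0 < gam by apply: lt_le_trans hgam.
have G0 : (0 < #|aperiodic_words|)%N.
  by have : (0 < #|B| ^ #|I|)%N; [rewrite expn_gt0 B0 | lia].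
apply: le_trans (second_moment halpha (fun w => @card_windows w) G0) _.
set Y := (1 + _) ^+ _; set X := gam ^- _.
have X0 : 0 <= X by rewrite invr_ge0 exprn_ge0 ?ltW.
have Y0 : 0 <= Y.
  by rewrite exprn_ge0// addr_ge0// mulr_ge0// invr_ge0 exprn_ge0 ?ltW.
have G0R : 0 < (#|aperiodic_words|%:R : R) by rewrite ltr0n.
apply: (@le_trans _ _ (4 / #|aperiodic_words|%:R ^+ 2 *
    (#|aperiodic_words|%:R * (#|B|%:R ^+ #|I| * X * Y)))).
  rewrite ler_wpM2l ?divr_ge0 ?exprn_ge0//.
  rewrite mulr_natl -sumr_const; apply: ler_sum => w wG.
  apply: le_trans (sum_shared_windows w).
  rewrite [leLHS]big_mkcond [leRHS]big_mkcond; apply: ler_sum => w' _.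
  case: (boolP (w' \in _)) => /= w'G; last first.
    by case: ifP => // _; rewrite invr_ge0 exprn_ge0 ?ltW.
  set K := [set q | _].
  have -> : windows w :&: windows w' = window w' @: K.
    apply/setP => p; rewrite !inE; apply/andP/imsetP => [[pw /imsetP[q _ e]]|[q + ->]].
      by exists q; rewrite // inE -e.
    by rewrite inE => ->; split=> //; apply: imset_f.
  by rewrite imset_eq0 card_imset//; apply/aperiodic_wordsP.
have : (#|B|%:R ^+ #|I| : R) <= 2 * #|aperiodic_words|%:R.
  by rewrite -natrX -natrM ler_nat.
move: G0R; set g := #|aperiodic_words|%:R; set b := _ ^+ #|I| => G0R bg.
have -> : 4 / g ^+ 2 * (g * (b * X * Y)) = 4 * (b / g) * (X * Y).
  by field; rewrite gt_eqF.
rewrite -[leRHS]mulrA ler_wpM2r ?mulr_ge0//.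
have : b / g <= 2 by rewrite ler_pdivrMr.
lra.
Qed.

End Windows.

From mathcomp Require Import finmap all_classical all_reals all_analysis.

Import numFieldNormedType.Exports.

(** * Words on a tile of a periodic tiling *)

(** Entries are generalised first: equal entries need not be syntactically
equal after [mxE]. *)
Ltac coord_lia :=
  rewrite ?mxE;
  repeat match goal with |- context [@fun_of_matrix _ _ _ ?M _ ?j] =>
    move: (@fun_of_matrix int 1 _ M ord0 j) => ? end;
  lia.

Lemma mem_cube d n (p : zlattice d) :
  (p \in cube d n) = [forall i, 0 <= p ord0 i < n%:Z].
Proof. by rewrite in_box; apply: eq_forallb => i; rewrite mxE add0r. Qed.

Lemma card_cube d n : #|{: cube d n}| = (n ^ d)%N.
Proof.
by apply: (@expnI 2) => //; rewrite -card_bool -[RHS]card_pattern card_ffun.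
Qed.

(** [T] is a tile for the group [L] of periods, and [r p] is the point of [T]
congruent to [p]. A function on [T] stands for an [L]-periodic configuration,
and a position in [T] for a class modulo [L]. *)
Section Tiling.
Variables (d : nat) (L : set (zlattice d)) (T : {fset zlattice d})
  (r : zlattice d -> T).
Hypotheses (LB : forall p q, L p -> L q -> L (p - q))
  (rP : forall p t, r p = t <-> L (p - val t)).

Let L0 : L 0.
Proof.
have Lx : L (0 - val (r 0)) by apply/rP.
by rewrite -(subrr (0 - val (r 0))); apply: LB.
Qed.

Let LN p : L p -> L (- p).
Proof. by move=> Lp; rewrite -[- p]add0r; apply: LB. Qed.

Let LD p q : L p -> L q -> L (p + q).
Proof. by move=> Lp /LN Lq; rewrite -[q]opprK; apply: LB. Qed.

Lemma residue_sub p : L (p - val (r p)).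
Proof. exact/rP. Qed.

Lemma residueE p q : r p = r q <-> L (p - q).
Proof.
rewrite rP; split=> Lpq.
  rewrite (_ : p - q = (p - val (r q)) - (q - val (r q))).
    by apply: LB => //; apply: residue_sub.
  by apply/rowP => i; coord_lia.
rewrite (_ : p - _ = (p - q) + (q - val (r q))).
  by apply: LD => //; apply: residue_sub.
by apply/rowP => i; coord_lia.
Qed.

Lemma residue_val t : r (val t) = t.
Proof. by apply/rP; rewrite subrr. Qed.

Lemma residue_addl p q : r (val (r p) + q) = r (p + q).
Proof.
apply/residueE; rewrite (_ : _ - _ = - (p - val (r p))).
  exact/LN/residue_sub.
by apply/rowP => i; coord_lia.
Qed.

Lemma residue_in_tile p : p \in T -> val (r p) = p.
Proof. by move=> pT; rewrite -[p in LHS]/(val [` pT]%fset) residue_val. Qed.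

Variable n : nat.

Definition translate (q : T) (s : cube d n) : T := r (val q + val s).

Lemma cube_bounds (s : cube d n) i : 0 <= val s ord0 i < n%:Z.
Proof. by have := valP s; rewrite mem_cube => /forallP/(_ i). Qed.

Hypothesis sep : forall p, L p -> (forall i, `|p ord0 i| <= 2 * n%:Z) -> p = 0.

Lemma translate_inj q : injective (translate q).
Proof.
move=> s s' /residueE; set p := _ - _ => Lp; apply/val_inj/eqP; rewrite -subr_eq0.
have E : val s - val s' = p by apply/rowP => i; coord_lia.
rewrite E; apply/eqP/sep => // i; rewrite -E.
by have := cube_bounds s i; have := cube_bounds s' i; coord_lia.
Qed.

(** Translation by the first basis vector permutes the tile, and a cube contains
a segment of [n] successive translates, so segments suffice for the cover. *)
Lemma translate_thin_cover (K : {set T}) : (0 < d)%N -> (0 < n)%N ->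
  exists2 K0 : {set T}, K0 \subset K &
    K \subset covered translate K0 /\
    (n * #|K0| <= 2 * #|covered translate K0|)%N.
Proof.
move=> d0 n0; pose e : zlattice d := delta_mx 0 (Ordinal d0).
pose sigma (q : T) := r (val q + e).
have sigma_inj : injective sigma.
  move=> q q' /residueE Lqq; rewrite -[q]residue_val -[q']residue_val.
  apply/residueE; suff <- : val q + e - (val q' + e) = val q - val q' by [].
  by apply/rowP => i; coord_lia.
have iterE j q : iter j sigma q = r (val q + e *+ j).
  elim: j => [|j IH]; first by rewrite mulr0n addr0 residue_val.
  by rewrite iterS IH /sigma residue_addl -addrA mulrSr.
have eE j i : (e *+ j) ord0 i = if i == Ordinal d0 then j%:Z else 0.
  rewrite mulmxnE mxE eqxx /=; case: eqVneq => _; last by rewrite mul0rn.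
  by rewrite -[RHS]natz.
have card_seg q : #|segment sigma n q| = n.
  rewrite card_imset ?card_ord// => j j'; rewrite !iterE => /residueE.
  set p := _ - _ => Lp; have pE i : p ord0 i = (e *+ j) ord0 i - (e *+ j') ord0 i.
    by rewrite /p; coord_lia.
  have p0 : p = 0.
    apply: sep => // i; rewrite pE !eE; have := ltn_ord j; have := ltn_ord j'.
    by case: ifP; lia.
  have := pE (Ordinal d0); rewrite p0 mxE !eE eqxx => jj.
  by apply/val_inj => /=; lia.
have [K0 K0K [KK0 card_K0]] := thin_segment_cover sigma_inj K n0 card_seg.
have sub : \bigcup_(k in K0) segment sigma n k \subset covered translate K0.
  apply/bigcupsP => q qK0; apply/fintype.subsetP => _ /segmentP[j jn ->].
  apply/bigcupP; exists q => //; apply/imsetP.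
  have ec : e *+ j \in cube d n.
    by rewrite mem_cube; apply/forallP => i; rewrite eE; case: ifP; lia.
  by exists [` ec]%fset; rewrite // /translate iterE.
exists K0 => //; split; first exact: fintype.subset_trans sub.
by rewrite (leq_trans card_K0)// leq_mul2l subset_leq_card.
Qed.

Section CommonWindow.
Variable B : finType.

(* A word with equal windows at q and q' is determined outside of the window
   at q': its value at place s of that window is the value at place s of the
   window at q, and when this position lies in the window at q' again, it does
   so at a place with a smaller i-th coordinate. *)
Let determined_by_coordinate (q q' : T) (i : 'I_d) :
  (forall s s' : cube d n, translate q s = translate q' s' ->
    val s' ord0 i < val s ord0 i) ->
  (#|[set w : {ffun T -> B} | window translate w q == window translate w q']|
     <= #|B| ^ (#|{: T}| - n ^ d))%N.
Proof.
move=> decr.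
have := @card_determined T B
  [set w : {ffun T -> B} | window translate w q == window translate w q']
  [set translate q' s | s in {: cube d n}].
rewrite card_imset ?card_cube; last exact: translate_inj.
apply=> w1 w2; rewrite !inE => /eqP/ffunP w1E /eqP/ffunP w2E eqw.
apply/ffunP => t; have [|tD] := boolP (t \in [set translate q' s | s in {: cube d n}]);
  last by apply: eqw; rewrite inE.
case/imsetP => s _ ->{t}.
have [m sm] : exists m : nat, val s ord0 i < m%:Z.
  by exists n; have /andP[] := cube_bounds s i.
elim: m s sm => [|m IH] s sm; first by move: sm; have := cube_bounds s i; coord_lia.
have := w1E s; have := w2E s; rewrite !ffunE => <- <-.
have [|tD] := boolP (translate q s \in [set translate q' s | s in {: cube d n}]);
  last by apply: eqw; rewrite inE.
case/imsetP => s' _ e; rewrite e; apply: IH; move: sm (decr _ _ e).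
by coord_lia.
Qed.

(** If the windows at [q] and [q'] overlap, all the overlaps come from the same
nonzero difference of places, because [L] has no short vector. A coordinate of
this difference that is nonzero decides in which direction to read the values
of one window off the other. *)
Lemma card_common_window (q q' : T) : q != q' ->
  (#|[set w : {ffun T -> B} | window translate w q == window translate w q']|
     <= #|B| ^ (#|{: T}| - n ^ d))%N.
Proof.
move=> qq'.
have neq_coord (p p' : zlattice d) : p != p' -> exists i, p ord0 i != p' ord0 i.
  by move=> /eqP pp'; apply/existsP; apply: contra_notT pp' => /existsPn pp';
     apply/rowP => i; apply/eqP/negPn.
have [[[s0 s0'] /= e0]|disj] :=
    pselect (exists ss, translate q ss.1 = translate q' ss.2); last first.
  have [|i _] := neq_coord (val q) (val q'); first by rewrite (inj_eq val_inj).
  apply: (determined_by_coordinate (i := i)) => s s' e.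
  by case: disj; exists (s, s').
have [i ne_i] : exists i, val s0 ord0 i != val s0' ord0 i.
  apply: neq_coord; apply: contra qq' => /eqP ss.
  move/residueE: e0; rewrite ss => Lqq; apply/eqP.
  rewrite -[q]residue_val -[q']residue_val; apply/residueE.
  suff <- : val q + val s0' - (val q' + val s0') = val q - val q' by [].
  by apply/rowP => j; coord_lia.
have same_diff s s' : translate q s = translate q' s' ->
    val s ord0 i - val s' ord0 i = val s0 ord0 i - val s0' ord0 i.
  move=> /residueE L1; move/residueE: e0 => L2; have := LB L1 L2.
  set p := _ - _ => Lp.
  have E j : p ord0 j = val s ord0 j - val s' ord0 j
                        - (val s0 ord0 j - val s0' ord0 j).
    by rewrite /p; coord_lia.
  have p0 : p = 0.
    apply: sep => // j; rewrite E.
    have := cube_bounds s j; have := cube_bounds s' j.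
    by have := cube_bounds s0 j; have := cube_bounds s0' j; coord_lia.
  by have := E i; rewrite p0; coord_lia.
have [lt|ge] := ltP (val s0' ord0 i) (val s0 ord0 i).
  apply: (determined_by_coordinate (i := i)) => s s' /same_diff; move: lt.
  by coord_lia.
rewrite (eq_card (B := [set w : {ffun T -> B} |
    window translate w q' == window translate w q])); last first.
  by move=> w; rewrite !inE eq_sym.
apply: (determined_by_coordinate (i := i)) => s s' /esym/same_diff.
by move: ge ne_i; coord_lia.
Qed.

End CommonWindow.

(** A window that meets several tiles meets each of them in frame points only:
tiles whose fillings agree on the frame can be put side by side freely. *)
Definition frame : {set T} :=
  [set t : T | `[< exists2 q, q \notin T &
               forall i, `|q ord0 i - val t ord0 i| <= n%:Z >]].

Lemma frameP (t : T) : reflect (exists2 q, q \notin T &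
    forall i, `|q ord0 i - val t ord0 i| <= n%:Z) (t \in frame).
Proof. by rewrite inE; apply: asboolP. Qed.

(** Let [c] be a point of the tile whose first coordinate is largest. Its
successor in that direction lies outside of the tile, close to all the points of
the window at [c]; and a point of this window outside of the tile of [c] has [c]
close to it. *)
Lemma frame_window_position : (0 < d)%N -> (0 < n)%N ->
  exists c : T, forall s, translate c s \in frame.
Proof.
move=> d0 n0; pose i0 := Ordinal d0.
pose c := [arg max_(t > r 0) (val t ord0 i0)]%O.
have cmax (t : T) : val t ord0 i0 <= val c ord0 i0.
  by rewrite /c; case: Order.TotalTheory.arg_maxP => //= u _; apply.
exists c => s; apply/frameP; have sb := cube_bounds s.
pose e : zlattice d := delta_mx 0 i0.
have [xT|xT] := boolP (val c + val s \in T).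
  exists (val c + e).
    by apply/negP => eT; have := cmax [` eT]%fset; rewrite /= !mxE !eqxx /=; coord_lia.
  move=> i; rewrite /translate residue_in_tile// !mxE.
  by have := sb i; case: (_ == _); coord_lia.
set t := translate c s.
exists (val t - val s); last first.
  by move=> i; have := sb i; coord_lia.
apply/negP => qT; have : r (val t - val s) = c.
  apply/rP; rewrite (_ : _ - _ = - (val c + val s - val t)).
    exact/LN/residue_sub.
  by apply/rowP => i; coord_lia.
move/(congr1 val); rewrite residue_in_tile// => tc.
by case/negP: xT; rewrite -tc subrK; apply: valP.
Qed.

Section Glue.
Variables (B : finType) (W : zlattice d -> {ffun T -> B}).

(** The tile of [s] is the translate of [T] by the period [s - val (r s)]. *)
Definition glue : config d B := fun s => W (s - val (r s)) (r s).

Hypothesis W_frame : forall l l', {in frame, W l =1 W l'}.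

(** Every window of a glued configuration is a window of a single periodic word:
the points of the window outside of the tile of [p] lie in the frame, where all
the fillings agree. *)
Lemma glue_window p : Defs.restrict (cube d n) (Defs.shift p glue) =
  window translate (W (p - val (r p))) (r p).
Proof.
apply/ffunP => s; rewrite !ffunE /Defs.shift /glue /translate residue_addl.
rewrite [val s + p]addrC; set t := r (p + val s).
have [<- //|ne] := eqVneq (p + val s - val t) (p - val (r p)).
apply: W_frame; apply/frameP; exists (val t - val s); last first.
  by move=> i; have := cube_bounds s i; coord_lia.
apply: contra ne => qT; have : r p = r (val t - val s).
  apply/residueE; rewrite (_ : _ - _ = p + val s - val t).
    exact: residue_sub.
  by apply/rowP => i; coord_lia.
move=> ->; rewrite residue_in_tile//; apply/eqP/rowP => i.
by coord_lia.
Qed.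

(** A window pattern [v] that all the fillings have at [c] marks the tiling: by
aperiodicity it occurs in the glued configuration at the translates of [c] by
periods and nowhere else. *)
Lemma glue_marker (c : T) (v : pattern d n B) :
  (forall l, W l \in aperiodic_words B translate) ->
  (forall l, window translate (W l) c = v) ->
  forall p, Defs.restrict (cube d n) (Defs.shift p glue) = v <-> r p = c.
Proof.
move=> Wap Wc p; rewrite glue_window; split=> [|->] //.
by rewrite -(Wc (p - val (r p))) => /(aperiodic_wordsP _ _ (Wap _)).
Qed.

End Glue.

(** If the ball of radius [n] around some point of the tile stays in the tile,
the points of this ball are pairwise incongruent, and their differences are all
the vectors of norm at most [2 * n]. *)
Lemma sparse_lattice : ~~ [forall t, t \in frame] ->
  forall p, L p -> (forall i, `|p ord0 i| <= 2 * n%:Z) -> p = 0.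
Proof.
case/forallPn => t tF p Lp pn.
have inT (q : zlattice d) : (forall i, `|q ord0 i| <= n%:Z) -> val t + q \in T.
  move=> qn; apply: contraNT tF => qT; apply/frameP; exists (val t + q) => // i.
  by have := qn i; coord_lia.
pose u : zlattice d := \row_i Num.max (- n%:Z) (Num.min n%:Z (p ord0 i)).
have u1 : val t + u \in T by apply: inT => i; have := pn i; coord_lia.
have u2 : val t + (u - p) \in T.
  by apply: inT => i; have := pn i; coord_lia.
have : r (val t + u) = r (val t + (u - p)).
  apply/residueE; suff -> : val t + u - (val t + (u - p)) = p by [].
  by apply/rowP => i; coord_lia.
move/(congr1 val); rewrite !residue_in_tile// => /addrI upE.
by apply/rowP => i; move/rowP/(_ i): upE; coord_lia.
Qed.

End Tiling.

Local Open Scope classical_set_scope.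

(** * The tile of a lattice basis and its boundary *)

Section FundamentalDomain.
Variables (R : realType) (d : nat) (L : set (zlattice d))
  (p : 'I_d -> zlattice d).
Hypotheses (latL : lattice L) (basisL : lattice_basis L p).

Let L0 : L 0. Proof. by case: latL. Qed.

Let LB q q' : L q -> L q' -> L (q - q').
Proof. by case: latL => _ LB _; apply: LB. Qed.

Let M : 'M[R]_d := \matrix_(i, j) (p i ord0 j)%:~R.

Let real_pointB (q q' : zlattice d) :
  real_point R (q - q') = real_point R q - real_point R q'.
Proof. by apply/rowP => j; rewrite !mxE intrB. Qed.

Let combE (s : 'I_d -> R) :
  \sum_i s i *: real_point R (p i) = (\row_i s i) *m M.
Proof.
apply/rowP => j; rewrite summxE mxE; apply: eq_bigr => i _.
by rewrite !mxE.
Qed.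

Let int_combE (c : 'rV[int]_d) :
  real_point R (\sum_i p i *~ c ord0 i) = real_point R c *m M.
Proof.
rewrite (_ : real_point R c = \row_i (c ord0 i)%:~R); last by apply/rowP => i; rewrite !mxE.
rewrite -combE; apply/rowP => j; rewrite mxE !summxE raddf_sum; apply: eq_bigr => i _.
by rewrite -scaler_int !mxE intz /= intrM.
Qed.

Let in_lattice (c : 'rV[int]_d) : L (\sum_i p i *~ c ord0 i).
Proof. by case: basisL => sub _ _; apply: sub. Qed.

Let latticeP q : L q -> exists c, real_point R q = real_point R c *m M.
Proof.
case: basisL => _ _ surj Lq; have [c _ <-] := surj _ Lq.
by exists c; rewrite int_combE.
Qed.

(* Two of the multiples of a unit vector are congruent, by finiteness of the
   index. *)
Let multiple_in_lattice (j : 'I_d) : exists2 k : nat, (0 < k)%N &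
  L (delta_mx 0 j *+ k).
Proof.
have fin : finite_set (cosets L) by case: latL.
pose e : zlattice d := delta_mx 0 j.
pose N := #|` fset_set (cosets L)|%fset.
have inC (k : nat) : [set q | L (q - e *+ k)] \in fset_set (cosets L).
  by rewrite in_fset_set// inE; exists (e *+ k).
pose f (k : 'I_N.+1) : fset_set (cosets L) := [` inC k]%fset.
have : ~~ injectiveb f.
  apply/negP => /injectiveP/leq_card; rewrite card_ord -cardfE -/N.
  by rewrite ltnn.
case/injectivePn => k [k' kk' /(congr1 val)/= fkk'].
wlog ltk : k k' kk' fkk' / (k < k')%N.
  move=> H; have [lt|lt|/val_inj eq] := ltngtP k k'; first exact: (H k k').
    by apply: (H k' k) => //; rewrite eq_sym.
  by move: kk'; rewrite eq eqxx.
exists (k' - k)%N; first by rewrite subn_gt0.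
have : [set q | L (q - e *+ k)] (e *+ k') by rewrite fkk' /= subrr.
by rewrite /= -mulrnBr ?(ltnW ltk).
Qed.

(* L contains a nonzero multiple of each unit vector, so the rows of M, which
   generate L, span the space. *)
Let unitM : M \in unitmx.
Proof.
have kP (j : 'I_d) : exists kc : nat * 'rV[int]_d, (0 < kc.1)%N /\
    real_point R (delta_mx 0 j *+ kc.1) = real_point R kc.2 *m M.
  have [k k0 /latticeP[c cE]] := multiple_in_lattice j.
  by exists (k, c).
have [f fP] := boolp.choice kP.
suff : (\matrix_j ((f j).1%:R^-1 *: real_point R (f j).2)) *m M = 1%:M.
  by case/mulmx1_unit.
apply/row_matrixP => j; rewrite row_mul rowK -scalemxAl.
have [f0 <-] := fP j.
rewrite row1; apply/rowP => i; rewrite !mxE eqxx /= mulmxnE mxE eqxx /=.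
case: (i == j) => /=; last by rewrite mul0rn mulr0.
have -> : ((1 *+ (f j).1 : int)%:~R = (f j).1%:R :> R) by rewrite natz.
by rewrite mulVf// pnatr_eq0 -lt0n.
Qed.

Let coord (q : zlattice d) (i : 'I_d) : R := (real_point R q *m invmx M) ord0 i.

Let coordB q q' i : coord (q - q') i = coord q i - coord q' i.
Proof. by rewrite /coord real_pointB mulmxBl !mxE. Qed.

Let coord_lattice (c : 'rV[int]_d) i :
  coord (\sum_i p i *~ c ord0 i) i = (c ord0 i)%:~R.
Proof. by rewrite /coord int_combE mulmxK// !mxE. Qed.

Let P := integer_points (fundamental_domain R p).

Let domainP q : P q <-> forall i, 0 <= coord q i < 1.
Proof.
split=> [[s s01 qE] i|q01].
  by rewrite /coord qE combE mulmxK// mxE.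
exists (coord q) => //; rewrite combE -[LHS](mulmxKV unitM).
by congr (_ *m _); apply/rowP => i; rewrite [RHS]mxE.
Qed.

Let domain_unique q q' : P q -> P q' -> L (q - q') -> q = q'.
Proof.
move=> /domainP Pq /domainP Pq'; case: basisL => _ _ surj /surj[c _ cE].
suff c0 : c = 0.
  apply/eqP; rewrite -subr_eq0 -cE c0 big1// => i _.
  by rewrite mxE mulr0z.
apply/rowP => i; rewrite mxE; have := coord_lattice c i; rewrite cE coordB.
have /andP[a0 a1] := Pq i; have /andP[b0 b1] := Pq' i => ci.
have ci1 : (c ord0 i)%:~R < (1 : int)%:~R :> R by rewrite -ci; lra.
have ciN1 : (- 1 : int)%:~R < (c ord0 i)%:~R :> R by rewrite -ci mulrN1z; lra.
by move: ci1 ciN1; rewrite !ltr_int; coord_lia.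
Qed.

Let domain_reduce q : exists2 t, P t & L (q - t).
Proof.
pose c : 'rV[int]_d := \row_i Num.floor (coord q i).
pose l := \sum_i p i *~ c ord0 i.
exists (q - l); last by rewrite opprB addrC subrK; apply: in_lattice.
apply/domainP => i; rewrite coordB coord_lattice mxE subr_ge0 floor_le /=.
by rewrite ltrBlDl -[X in _ + X]/((1 : int)%:~R) -intrD floorD1_gt.
Qed.

(** Taking integer parts of the coordinates in the basis moves each point into
the fundamental domain, and a period with all coordinates in (-1, 1) vanishes.
So the integer points of the fundamental domain represent each class once. *)
Lemma fundamental_tiling : exists (T : {fset zlattice d}) (r : zlattice d -> T),
  [/\ [set` T] = P, forall q (t : T), r q = t <-> L (q - val t)
    & #|{: T}| = vol L].
Proof.
have finC : finite_set (cosets L) by case: latL.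
pose cos (q : zlattice d) : set (zlattice d) := [set q' | L (q' - q)].
have cos_inj : {in P &, injective cos}.
  move=> q q'; rewrite !inE => Pq Pq' qq'; apply: domain_unique => //.
  have : cos q q by rewrite /cos /= subrr.
  by rewrite qq'.
have finP : finite_set P.
  pose g (C : set (zlattice d)) := xget 0 (P `&` C).
  apply: sub_finite_set (finite_image g finC) => q Pq; exists (cos q).
    by exists q.
  rewrite /g; have : (P `&` cos q) q by split=> //; rewrite /cos /= subrr.
  by case/(@xgetI _ 0) => Pg Lg; apply: domain_unique.
have imP : cos @` P = cosets L.
  rewrite eqEsubset; split=> [_ [q Pq <-]|_ [q _ <-]]; first by exists q.
  have [t Pt Lqt] := domain_reduce q; exists t => //.
  rewrite eqEsubset; split=> x /= Lx.
    by have := LB Lx Lqt; congr L; apply/rowP => i; coord_lia.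
  have := LB Lx (LB L0 Lqt); congr L; apply/rowP => i; coord_lia.
pose T := fset_set P.
have TP q : q \in T = (q \in P) by rewrite in_fset_set.
have rex q : exists t : T, L (q - val t).
  have [t Pt Lt] := domain_reduce q.
  have tT : t \in T by rewrite TP inE.
  by exists [` tT]%fset.
have [r rP] := boolp.choice rex.
exists T, r; split; first exact: fset_setK.
  move=> q t; split=> [<- //|Lt]; apply/val_inj/domain_unique.
  - by have := valP (r q); rewrite TP inE.
  - by have := valP t; rewrite TP inE.
  - by have := LB Lt (rP q); congr L; apply/rowP => i; coord_lia.
rewrite /vol -imP fset_set_image// card_in_imfset /=.
  by rewrite -cardfE.
by move=> q q'; rewrite !TP; apply: cos_inj.
Qed.

End FundamentalDomain.

Lemma sup_norm_le d (p : zlattice d) (n : nat) :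
  (`|p| <= n%:Z) = [forall i, `|p ord0 i| <= n%:Z].
Proof.
rewrite [leLHS]mx_normrE; apply/bigmax_leP/forallP => [[_ le] i|le].
  exact: (le (ord0, i)).
by split=> // -[i j] _ /=; rewrite [i]ord1.
Qed.

Section OuterBoundary.
Variables (R : realType) (d : nat) (T : {fset zlattice d}) (n : nat).
Let D := outer_boundary (n%:R : R) [set` T].

Lemma outer_boundary_near q t : q \notin T -> t \in T ->
  (forall i, `|q ord0 i - t ord0 i| <= n%:Z) -> D q.
Proof.
move=> qT tT qt; split; first exact/negP.
apply: (@le_trans _ _ (((`|q - t| : int)%:~R : R)%:E)).
  by apply: ereal_inf_lbound; exists t.
rewrite lee_fin -[leRHS]/((n%:Z)%:~R) ler_int sup_norm_le.
by apply/forallP => i; rewrite !mxE.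
Qed.

Lemma finite_outer_boundary : finite_set D.
Proof.
pose N (t : zlattice d) := [set` box (t - const_mx n.+1%:Z) (fun=> (2 * n.+1).+1)].
apply: (@sub_finite_set _ _ (\bigcup_(t in [set` T]) N t)); last first.
  by apply: bigcup_finite => // t _; apply: finite_fset.
move=> q [_ qT].
have : (dist_to R q [set` T] < (n.+1)%:R%:E)%E.
  by apply: le_lt_trans qT _; rewrite lte_fin ltr_nat.
case/ereal_inf_lt => _ [t tT <-]; rewrite lte_fin => qt; exists t => //=.
have {qt} : `|q - t| <= n.+1%:Z.
  by apply: ltW; rewrite -(ltr_int R).
rewrite sup_norm_le /N /= in_box => /forallP qt; apply/forallP => i.
by have := qt i; rewrite !mxE; coord_lia.
Qed.

Variables (L : set (zlattice d)) (r : zlattice d -> T).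
Hypotheses (LB : forall p q, L p -> L q -> L (p - q))
  (rP : forall p t, r p = t <-> L (p - val t)).

(** A frame point [t] sees a point [q] outside of [T]. The period that moves [q]
into [T] moves [t] out of [T] but close to it, and [t] is recovered as the
residue of its image. *)
Lemma card_frame_le : (#|frame T n| <= #|` fset_set D|)%N.
Proof.
have ex (t : T) : exists q, t \in frame T n -> q \notin T /\
    forall i, `|q ord0 i - val t ord0 i| <= n%:Z.
  have [/frameP[q qT qt]|tF] := boolP (t \in frame T n); first by exists q.
  by exists 0.
have [q qP] := boolp.choice ex.
pose g (t : T) : zlattice d := val t - q t + val (r (q t)).
have rg t : r (g t) = t.
  rewrite rP (_ : g t - val t = 0 - (q t - val (r (q t)))).
    by apply: LB; [have := residue_sub rP (q t) => Lq;
       rewrite -(subrr (q t - val (r (q t)))); apply: LB | apply/rP].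
  by apply/rowP => i; rewrite /g; coord_lia.
have g_inj : injective g by move=> t t' /(congr1 r); rewrite !rg.
have gD t : t \in frame T n -> g t \in fset_set D.
  move=> tF; have [qT qt] := qP t tF; rewrite in_fset_set ?inE; last first.
    exact: finite_outer_boundary.
  apply: (@outer_boundary_near _ (val (r (q t)))); last 2 first.
  - exact: valP.
  - by move=> i; have := qt i; rewrite /g; coord_lia.
  apply: contra qT => gT; have := residue_in_tile LB rP gT; rewrite rg => /eqP.
  rewrite /g -subr_eq0 opprD opprB addrA addrC [_ + (q t - _)]addrC subrK.
  by rewrite addrC subr_eq0 => /eqP ->; apply: valP.
have <- : #|` [fset g t | t in frame T n]%fset| = #|frame T n|.
  by rewrite card_imfset//= -cardE.
by apply/fsubset_leq_card/fsubsetP => _ /imfsetP[t /= tF ->]; apply: gD.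
Qed.

End OuterBoundary.

(** * Entropy and the number of patterns on large shapes *)

Section Language.
Variables (d : nat) (A : finType) (X : set (config d A)).

Lemma in_language (S : {fset zlattice d}) x q : X x ->
  Defs.restrict S (Defs.shift q x) \in language S X.
Proof. by move=> Xx; rewrite inE; apply/asboolP; exists x => //; exists q. Qed.

Lemma languageP (S : {fset zlattice d}) w : w \in language S X ->
  exists2 x, X x & exists q, Defs.restrict S (Defs.shift q x) = w.
Proof. by rewrite inE => /asboolP. Qed.

Lemma card_box (a : zlattice d) (m : 'I_d -> nat) :
  #|` box a m|%fset = (\prod_i m i)%N.
Proof.
rewrite card_imfset /=; last first.
  move=> k l /addrI/rowP kl; apply/ffunP => i; apply/val_inj.
  by have := kl i; rewrite !mxE => -[].
rewrite -cardE card_dep_ffun foldrE big_map big_enum /=.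
by apply: eq_bigr => i _; rewrite card_ord.
Qed.

(** Cut the lattice into boxes of side lengths [m]. The boxes that meet [T] are
disjoint and lie in [T'], and the patterns seen in them determine the pattern
on [T]. *)
Lemma language_tiling (m : 'I_d -> nat) (M : nat) (a : zlattice d)
    (T T' : {fset zlattice d}) :
  (forall i, (0 < m i <= M)%N) ->
  (forall t p : zlattice d, t \in T -> (forall i, `|p ord0 i - t ord0 i| <= M%:Z) ->
    p \in T') ->
  exists2 k : nat, (k * \prod_i m i <= #|` T'|%fset)%N &
    (#|language T X| <= #|language (box a m) X| ^ k)%N.
Proof.
move=> m_bounds T'P.
pose corner (p : zlattice d) : zlattice d :=
  \row_i ((p ord0 i %/ m i)%Z * (m i)%:Z).
have cornerE (p : zlattice d) i : corner p ord0 i <= p ord0 i < corner p ord0 i + (m i)%:Z.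
  rewrite mxE; have /andP[m0 _] := m_bounds i.
  have m0' : (0 < (m i)%:Z) by rewrite ltz_nat.
  have := divz_eq (p ord0 i) (m i); have := modz_ge0 (p ord0 i) (lt0r_neq0 m0').
  have := ltz_pmod (p ord0 i) m0'.
  by move: ((p ord0 i %/ m i)%Z * (m i)%:Z) (p ord0 i %% m i)%Z => a' b'; coord_lia.
pose C := [fset corner t | t in T]%fset.
exists #|` C|%fset.
  pose f (cj : C * {dffun forall i, 'I_(m i)}) : zlattice d :=
    val cj.1 + \row_i (cj.2 i : nat)%:Z.
  have corner_f cj : corner (f cj) = val cj.1.
    case: cj => c j; have /imfsetP[/= t tT cE] := valP c.
    apply/rowP => i; rewrite /f /= cE !mxE.
    have /andP[m0 _] := m_bounds i.
    rewrite divzMDl; last by lia.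
    rewrite [((j i : nat)%:Z %/ _)%Z]divz_small ?addr0//.
    by have := ltn_ord (j i); lia.
  have f_inj : injective f.
    move=> cj cj' ff; have cc : cj.1 = cj'.1 by apply/val_inj; rewrite -!corner_f ff.
    case: cj cj' cc ff => c j [c' j'] /= <- /addrI/rowP jj; congr (_, _).
    by apply/ffunP => i; apply/val_inj; have := jj i; rewrite !mxE => -[].
  have fT' cj : f cj \in T'.
    have /imfsetP[/= t tT cE] := valP cj.1.
    apply: (T'P t) => // i; have := cornerE t i.
    have -> : f cj ord0 i = corner t ord0 i + (cj.2 i : nat)%:Z.
      by rewrite /f /= cE mxE [X in _ + X]mxE.
    have := ltn_ord (cj.2 i); have /andP[_ +] := m_bounds i.
    by move: (corner t ord0 i) => c; coord_lia.
  have := @leq_card _ T' (fun cj => [` fT' cj]%fset).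
  rewrite card_prod -!cardfE card_dep_ffun foldrE big_map big_enum /=.
  under eq_bigr do rewrite card_ord.
  by apply=> cj cj' /(congr1 val)/= /f_inj.
have [->|[w0 /languageP[x0 _ _]]] := set_0Vmem (language T X); first by rewrite cards0.
have preimage w : exists xq : config d A * zlattice d, w \in language T X ->
    X xq.1 /\ Defs.restrict T (Defs.shift xq.2 xq.1) = w.
  have [/languageP[x Xx [q qE]]|_] := boolP (w \in language T X).
    by exists (x, q).
  by exists (x0, 0).
have [xq xqP] := boolp.choice preimage.
pose g w : {ffun C -> {ffun box a m -> A}} :=
  [ffun c : C => Defs.restrict (box a m)
    (Defs.shift ((xq w).2 + val c - a) (xq w).1)].
have g_inj : {in language T X &, injective g}.
  move=> w w' wL w'L /ffunP gg; have [_ <-] := xqP w wL; have [_ <-] := xqP w' w'L.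
  apply/ffunP => t; rewrite !ffunE /Defs.shift.
  have cC : corner (val t) \in C by apply/imfsetP; exists (val t) => //=; apply: valP.
  have ub : val t - corner (val t) + a \in box a m.
    rewrite in_box; apply/forallP => i; have := cornerE (val t) i.
    have -> : (val t - corner (val t) + a) ord0 i =
        val t ord0 i - corner (val t) ord0 i + a ord0 i by rewrite !mxE.
    by move: (corner (val t) ord0 i) => c; coord_lia.
  have := gg [` cC]%fset; rewrite !ffunE => /ffunP/(_ [` ub]%fset).
  rewrite !ffunE /Defs.shift /= => e; have idx q : val t + q =
      val t - corner (val t) + a + (q + corner (val t) - a).
    by apply/rowP => i; rewrite !mxE; ring.
  by rewrite (idx (xq w).2) (idx (xq w').2).
rewrite -(card_in_imset g_inj).
apply: (@leq_trans #|ffun_on (mem (language (box a m) X)) : {pred {ffun C -> _}}|).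
  apply/subset_leq_card/fintype.subsetP => _ /imsetP[w wL ->].
  apply/ffun_onP => c; rewrite ffunE; apply: in_language.
  by have [] := xqP w wL.
by rewrite card_ffun_on -cardfE.
Qed.

End Language.

Section Entropy.
Variables (R : realType) (d : nat) (A : finType) (X : set (config d A)).
Hypothesis X0 : X !=set0.

Definition log_complexity (S : {fset zlattice d}) : R := ln #|language S X|%:R.

Let language_gt0 S : (0 < #|language S X|)%N.
Proof.
have [x Xx] := X0; apply/card_gt0P.
by exists (Defs.restrict S (Defs.shift 0 x)); apply: in_language.
Qed.

Lemma log_complexity_ge0 S : 0 <= log_complexity S.
Proof. by rewrite ln_ge0// ler1n. Qed.

Lemma log_complexity_tiling (m : 'I_d -> nat) (M : nat) (a : zlattice d)
    (T T' : {fset zlattice d}) :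
  (forall i, (0 < m i <= M)%N) ->
  (forall t p : zlattice d, t \in T ->
    (forall i, `|p ord0 i - t ord0 i| <= M%:Z) -> p \in T') ->
  (\prod_i m i)%:R * log_complexity T <= #|` T'|%fset%:R * log_complexity (box a m).
Proof.
move=> m_bounds T'P.
have [k km LT] := language_tiling X a m_bounds T'P.
apply: (@le_trans _ _ ((\prod_i m i)%:R * (k%:R * log_complexity (box a m)))).
  rewrite ler_wpM2l// mulr_natl -lnXn ?ltr0n// -natrX ler_ln ?posrE ?ltr0n//.
    by rewrite ler_nat.
  by rewrite expn_gt0 language_gt0.
by rewrite mulrA ler_wpM2r ?log_complexity_ge0// -natrM ler_nat mulnC.
Qed.

Let u (n : 'I_d -> nat) : R :=
  (\prod_i (n i)%:R)^-1 * log_complexity (box (const_mx 1) n).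

Lemma all_infty_filter : ProperFilter (all_infty d).
Proof.
apply: filter_from_proper; last by move=> N _; exists (fun=> N) => i.
apply: filter_from_filter; first by exists 0%N.
move=> N N' _ _; exists (maxn N N') => // n nN; split=> i.
  exact: leq_trans (leq_maxl _ _) (nN i).
exact: leq_trans (leq_maxr _ _) (nN i).
Qed.

Let box_enlarge (m n : 'I_d -> nat) (M : nat) :
  (forall i, (0 < m i <= M)%N) -> (forall i, (0 < n i)%N) ->
  u n <= \prod_i (1 + (2 * M)%:R / (n i)%:R) * u m.
Proof.
move=> m_bounds n0.
have pm0 : 0 < \prod_i (m i)%:R :> R.
  by apply: prodr_gt0 => i _; rewrite ltr0n; case/andP: (m_bounds i).
have pn0 : 0 < \prod_i (n i)%:R :> R by apply: prodr_gt0 => i _; rewrite ltr0n.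
have near_box (t p : zlattice d) : t \in box (const_mx 1) n ->
    (forall i, `|p ord0 i - t ord0 i| <= M%:Z) ->
    p \in box (const_mx (1 - M%:Z)) (fun i => n i + 2 * M)%N.
  rewrite !in_box => /forallP tn pt; apply/forallP => i.
  by have := tn i; have := pt i; coord_lia.
have := log_complexity_tiling (const_mx 1) m_bounds near_box.
rewrite card_box !natr_prod => le.
have -> : \prod_i (1 + (2 * M)%:R / (n i)%:R) =
    (\prod_i (n i + 2 * M)%:R) / \prod_i (n i)%:R :> R.
  rewrite -prodfV -big_split /=; apply: eq_bigr => i _.
  by rewrite natrD mulrDl mulfV// pnatr_eq0 -lt0n.
rewrite /u; set lT := log_complexity _ in le *.
set lm := log_complexity _ in le *; set Q := \prod_i (_ + _)%:R in le *.
have {}le : lT <= Q * lm / \prod_i (m i)%:R by rewrite ler_pdivlMr// mulrC.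
have -> : Q / \prod_i (n i)%:R * ((\prod_i (m i)%:R)^-1 * lm) =
    (\prod_i (n i)%:R)^-1 * (Q * lm / \prod_i (m i)%:R) by ring.
by rewrite ler_wpM2l// invr_ge0 ltW.
Qed.

Let h := inf [set u m | m in [set m | forall i, (0 < m i)%N]].

Let u_ge0 m : 0 <= u m.
Proof. by rewrite mulr_ge0 ?log_complexity_ge0// invr_ge0 prodr_ge0. Qed.

Let has_inf_u : has_inf [set u m | m in [set m | forall i, (0 < m i)%N]].
Proof.
split; first by exists (u (fun=> 1%N)), (fun=> 1%N).
by exists 0 => _ [m _ <-]; apply: u_ge0.
Qed.

Let growth_cvg (M : nat) (c : R) :
  (1 + (2 * M)%:R * harmonic n) ^+ d * c @[n --> \oo] --> c.
Proof.
rewrite -[X in _ --> X]mul1r; apply: cvgMl.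
have c1 : (1 + (2 * M)%:R * harmonic n) @[n --> \oo] --> (1 : R).
  rewrite -[X in _ --> X](addr0 1) -[X in _ + X](mulr0 (2 * M)%:R).
  by apply: cvgD; [exact: cvg_cst | apply: cvgMr; exact: cvg_harmonic].
rewrite -[X in _ --> X](expr1n R d).
exact: (cvg_comp _ _ c1 (@exprn_continuous R d 1)).
Qed.

Let u_cvg : u n @[n --> all_infty d] --> h.
Proof.
have FF := all_infty_filter.
apply/cvgrPdist_lt => eps eps0.
have [_ [m m0 <-] um] := inf_adherent eps0 has_inf_u.
pose M := \max_i m i.
have m_bounds i : (0 < m i <= M)%N by rewrite m0 leq_bigmax.
have [N _ NP] : \forall n \near \oo,
    (1 + (2 * M)%:R * harmonic n) ^+ d * u m < h + eps.
  by apply: (cvgr_lt (u m)); [exact: growth_cvg | exact: um].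
exists N.+1 => // n /= nN.
have n0 i : (0 < n i)%N by apply: leq_trans (nN i).
have hu : h <= u n.
  by apply: ge_inf; [case: has_inf_u | exists n].
rewrite distrC ger0_norm ?subr_ge0// ltrBlDl.
apply: le_lt_trans (box_enlarge m_bounds n0) _.
apply: le_lt_trans (NP N (leqnn N)); rewrite ler_wpM2r//.
rewrite -[X in _ ^+ X]card_ord -prodr_const; apply: ler_prod => i _.
rewrite addr_ge0 ?divr_ge0//= lerD2l ler_wpM2l// /harmonic /=.
by rewrite lef_pV2 ?posrE ?ltr0n// ler_nat.
Qed.

(** The limit in the definition exists and is the infimum over all boxes: by
subadditivity each box [m] bounds the larger boxes, up to a factor which counts
the cells that stick out and tends to 1. *)
Lemma entropyE : entropy R X = h%:E.
Proof.
have FF := all_infty_filter.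
apply/cvg_lim => //; apply: cvg_EFin.
  by apply: nearW => n; rewrite lne_EFin ?ltr0n.
apply: cvg_trans u_cvg; apply: near_eq_cvg; apply: nearW => n /=.
by rewrite leNgt ltr0n language_gt0.
Qed.

Lemma entropy_lt_box (a : R) : (entropy R X < a%:E)%E ->
  exists2 m : 'I_d -> nat, forall i, (0 < m i)%N &
    log_complexity (box (const_mx 1) m) < (\prod_i m i)%:R * a.
Proof.
rewrite entropyE lte_fin => ha; have [ne _] := has_inf_u.
have [_ [m m0 <-] um] := inf_lt ne ha; exists m => //.
by rewrite natr_prod -ltr_pdivrMl// prodr_gt0// => i _; rewrite ltr0n; apply: m0.
Qed.

End Entropy.

(** * Coding a subshift tile by tile *)

Lemma card_le_injection (U V : finType) (E : {set U}) (C : {set V}) :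
  (#|E| <= #|C|)%N -> (0 < #|C|)%N ->
  exists2 f : U -> V, {in E &, injective f} & forall w, w \in E -> f w \in C.
Proof.
move=> EC /card_gt0P[v0 _].
have idx w : w \in E -> (index w (enum E) < size (enum C))%N.
  move=> wE; rewrite -cardE; apply: leq_trans EC.
  by rewrite cardE index_mem mem_enum.
exists (fun w => nth v0 (enum C) (index w (enum E))); last first.
  by move=> w wE; rewrite -(mem_enum C) mem_nth ?idx.
move=> w w' wE w'E /eqP; rewrite nth_uniq ?enum_uniq ?idx// => /eqP e.
by have := congr1 (nth w (enum E)) e; rewrite !nth_index ?mem_enum.
Qed.

Section ConfigTopology.
Variables (d : nat) (A : finType).

Lemma near_config (x : config d A) (s : zlattice d) :
  \forall x' \near x, x' s = x s.
Proof.
have nxs : nbhs (x s : discrete_topology A) [set a | a = x s].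
  by rewrite nbhs_principalE; apply/principal_filterP.
exact: (@proj_continuous _ (fun _ : zlattice d => discrete_topology A) s x _ nxs).
Qed.

Lemma cvg_config (F : set_system (config d A)) (y : config d A) : Filter F ->
  (forall s, F [set y' | y' s = y s]) -> F --> y.
Proof.
move=> FF Fy; apply/cvg_sup => s U; rewrite nbhsE => -[B [[C oC CB] By] BU].
apply: filterS (Fy s) => y' y's; apply: BU; rewrite -CB /=.
by move: By; rewrite -CB /= /proj y's.
Qed.

Lemma shift_shift (p q : zlattice d) (x : config d A) :
  Defs.shift p (Defs.shift q x) = Defs.shift (p + q) x.
Proof. by apply/funext => s; rewrite /Defs.shift addrA. Qed.

End ConfigTopology.

Lemma within_continuous_config d (A B : finType) (X : set (config d A))
    (phi : config d A -> config d B) :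
  {within X, continuous phi} <->
  forall x s, X x -> \forall x' \near x, X x' -> phi x' s = phi x s.
Proof.
have nbhsX x : X x -> nbhs (x : subspace X) = within X (nbhs x).
  by move=> Xx; case: (nbhs_subspaceP X x).
split=> [cphi x s Xx|near_phi x].
  by have := cphi x _ (near_config (phi x) s); rewrite nbhs_simpl /= nbhsX.
have [Xx|nXx] := pselect (X x); last first.
  have nx : nbhs (x : subspace X) = globally [set x].
    by case: (nbhs_subspaceP X x).
  by move=> U /nbhs_singleton Ux; rewrite nbhs_simpl /= nx => y /= ->.
apply: cvg_config => s.
suff : nbhs (x : subspace X) [set x' | phi x' s = phi x s] by [].
by rewrite nbhsX//; apply: near_phi.
Qed.

Section Embedding.
Variables (d : nat) (A AO B : finType) (X : set (config d A))
  (O : set (config d AO)) (pi : config d A -> config d AO) (L : set (zlattice d))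
  (z : config d AO).
Hypotheses (X_shift : forall t x, X x -> X (Defs.shift t x)) (X0 : X !=set0)
  (finO : finite_set O) (Oz : O = range (fun t => Defs.shift t z))
  (piP : shift_map X O pi) (latO : associated_lattice O L).
Variables (T : {fset zlattice d}) (r : zlattice d -> T).
Hypotheses (LB : forall p q, L p -> L q -> L (p - q))
  (rP : forall p t, r p = t <-> L (p - val t)).
Variables (n : nat) (F : {set pattern d n B}) (C : {set {ffun T -> B}}).
Hypotheses (d0 : (0 < d)%N) (n0 : (0 < n)%N)
  (C_aperiodic : forall w, w \in C -> w \in aperiodic_words B (@translate d T r n))
  (C_allowed : forall w q, w \in C -> window (@translate d T r n) w q \notin F)
  (C_frame : forall w w', w \in C -> w' \in C -> {in frame T n, w =1 w'})
  (C_large : (#|language T X| <= #|C|)%N).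

(* The phase of x is the position of the tiling attached to x, read off from the
   periodic factor; it is well defined modulo L. *)
Let phase (x : config d A) : zlattice d := xget 0 [set a | pi x = Defs.shift a z].

Let phaseP x : X x -> pi x = Defs.shift (phase x) z.
Proof.
case: piP => _ piO _ /piO; rewrite Oz => -[a _ az].
by apply: (@xgetPex _ 0 [set a | pi x = Defs.shift a z]); exists a.
Qed.

Let period a b : Defs.shift a z = Defs.shift b z -> L (a - b).
Proof.
move=> ab; have Ozz : O z.
  by rewrite Oz; exists 0 => //; apply/funext => s; rewrite /Defs.shift addr0.
rewrite -(latO Ozz) /= -shift_shift; apply/funext => s.
have := congr1 (fun y : config d AO => y (s - b)) ab.
rewrite /Defs.shift subrK => <-; congr (z _).
by apply/rowP => i; coord_lia.
Qed.

Let phase_shift t x : X x -> L (phase (Defs.shift t x) - (t + phase x)).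
Proof.
move=> Xx; apply: period; rewrite -phaseP; last exact: X_shift.
by case: piP => _ _ ->//; rewrite phaseP// shift_shift.
Qed.

(** The tiling attached to [x] commutes with shifts, and each of its tiles is
filled with a code word in [C] for the pattern of [x] on that tile. Each window
of the result is a window of some word of [C], hence allowed. The result
determines the tiling up to periods, by the positions of a marker window, and
then the pattern of [x] on each tile. *)
Lemma tile_coding : embeds X (random_sft F).
Proof.
have [x0 Xx0] := X0.
have C_gt0 : (0 < #|C|)%N.
  apply: leq_trans C_large; apply/card_gt0P.
  by exists (Defs.restrict T (Defs.shift 0 x0)); apply: in_language.
have [code code_inj codeC] := card_le_injection C_large C_gt0.
pose tiles x (l : zlattice d) := code (Defs.restrict T (Defs.shift (l - phase x) x)).
pose phi x := Defs.shift (phase x) (glue r (tiles x)).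
have tilesC x l : X x -> tiles x l \in C by move=> Xx; apply/codeC/in_language.
have tiles_frame x : X x -> forall l l', {in frame T n, tiles x l =1 tiles x l'}.
  by move=> Xx l l'; apply: C_frame; apply: tilesC.
have phiE x s : phi x s =
    code (Defs.restrict T (Defs.shift (s - val (r (s + phase x))) x)) (r (s + phase x)).
  rewrite /phi /Defs.shift /glue /tiles /Defs.shift; congr (code _ _).
  apply/ffunP => t; rewrite !ffunE.
  by congr (x _); apply/rowP => i; coord_lia.
have [c c_frame] := frame_window_position LB rP d0 n0.
have [w0 w0C] := card_gt0P C_gt0.
pose v := window (@translate d T r n) w0 c.
have tiles_marker x l : X x -> window (@translate d T r n) (tiles x l) c = v.
  move=> Xx; apply/ffunP => s; rewrite !ffunE.
  by apply: C_frame (c_frame s) => //; apply: tilesC.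
have marker x p : X x ->
    Defs.restrict (cube d n) (Defs.shift p (glue r (tiles x))) = v <-> r p = c.
  move=> Xx; apply: (glue_marker LB rP (tiles_frame x Xx)) => l.
    by apply/C_aperiodic/tilesC.
  exact: tiles_marker.
exists phi; first split.
- apply/within_continuous_config => x s Xx.
  have [cpi piO _] := piP; move/within_continuous_config : cpi => cpi.
  (* The orbit is finite, so finitely many coordinates separate pi x from its
     other points. *)
  have near_pi : \forall x' \near x, X x' -> pi x' = pi x.
    have dist y : exists s', y <> pi x -> y s' <> pi x s'.
      have [->|ne] := pselect (y = pi x); first by exists 0.
      have [s' s'P] : exists s', y s' <> pi x s'.
        by apply/existsNP => same; apply: ne; apply/funext.
      by exists s'.
    have [f fP] := boolp.choice dist.
    have : \forall x' \near x, (\bigcap_(y in [set` fset_set O])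
        [set x' | X x' -> pi x' (f y) = pi x (f y)]) x'.
      by apply: filter_bigI => y _; exact: (cpi x (f y) Xx).
    apply: filterS => x' near Xx'; apply: contrapT => ne.
    apply: (fP _ ne); apply: near => //=.
    by rewrite in_fset_set// inE; apply: piO.
  have near_x : \forall x' \near x, forall t : T,
      x' (val t + (s - val (r (s + phase x)))) = x (val t + (s - val (r (s + phase x)))).
    apply: (@filter_forall (config d A) T (fun t => [set x' : config d A |
      x' (val t + (s - val (r (s + phase x)))) = x (val t + (s - val (r (s + phase x))))])
      (nbhs x) (nbhs_filter x)) => t.
    exact: near_config.
  near=> x' => Xx'.
  have phx : phase x' = phase x.
    by rewrite /phase (near near_pi x')//; near: x'.
  rewrite !phiE phx; congr (code _ _); apply/ffunP => t; rewrite !ffunE.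
  by move: t; near: x'.
- move=> x Xx p; rewrite /phi shift_shift (glue_window LB rP (tiles_frame x Xx)).
  exact/C_allowed/tilesC.
- move=> t x Xx; apply/funext => s; rewrite phiE /Defs.shift phiE.
  have -> : r (s + phase (Defs.shift t x)) = r (s + t + phase x).
    apply/(residueE LB rP); have := phase_shift t Xx; congr L.
    by apply/rowP => i; coord_lia.
  congr (code _ _); apply/ffunP => u; rewrite !ffunE /Defs.shift.
  by congr (x _); apply/rowP => i; coord_lia.
move=> x x'; rewrite !inE => Xx Xx' phixx'.
(* Both results have the marker window at p. *)
have Lphase : L (phase x - phase x').
  pose p := val c - phase x.
  have rx : r (p + phase x) = c by rewrite subrK (residue_val LB rP).
  have rx' : r (p + phase x') = c.
    by apply/(marker x' _ Xx'); rewrite -shift_shift -/(phi x') -phixx' /phi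
      shift_shift; apply/marker.
  have := rx; rewrite -[in RHS]rx' => /(residueE LB rP); congr L.
  by apply/rowP => i; coord_lia.
apply/funext => q; pose t := r (q + phase x).
have code_at (t' : T) y : X y -> L (phase y - phase x) ->
    phi y (val t' + (q - val t)) =
    code (Defs.restrict T (Defs.shift (q - val t) y)) t'.
  move=> Xy Lyx; rewrite phiE.
  have -> : r (val t' + (q - val t) + phase y) = t'.
    apply/rP; rewrite (_ : _ - _ = (q + phase x - val t) - (0 - (phase y - phase x))).
      have L0 := LB Lyx Lyx; rewrite subrr in L0.
      by apply: (LB _ (LB L0 Lyx)); apply: (residue_sub rP).
    by apply/rowP => i; coord_lia.
  congr (code _ _); apply/ffunP => u; rewrite !ffunE /Defs.shift.
  by congr (y _); apply/rowP => i; coord_lia.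
have Lxx : L (phase x - phase x) by rewrite subrr -(subrr (phase x - phase x')); apply: LB.
have Lx'x : L (phase x' - phase x).
  have -> : phase x' - phase x = (phase x - phase x) - (phase x - phase x').
    by apply/rowP => i; coord_lia.
  exact: LB.
have : Defs.restrict T (Defs.shift (q - val t) x) =
       Defs.restrict T (Defs.shift (q - val t) x').
  apply: code_inj; [exact: in_language..|].
  by apply/ffunP => t'; rewrite -(code_at t' x)// -(code_at t' x')// phixx'.
move/ffunP/(_ t); rewrite !ffunE /Defs.shift.
by have -> : val t + (q - val t) = q by apply/rowP => i; coord_lia.
Unshelve. all: by end_near. Qed.

End Embedding.

(** * One scale *)

Lemma large_fiber (U V : finType) (f : U -> V) (E : {set U}) : (0 < #|V|)%N ->
  exists v, (#|E| <= #|[set w in E | f w == v]| * #|V|)%N.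
Proof.
case/card_gt0P => v0 _.
pose fib v := #|[set w in E | f w == v]|.
exists [arg max_(v > v0) fib v]; case: arg_maxnP => // v _ vmax.
rewrite -/(fib v) mulnC -sum_nat_const.
have -> : #|E| = (\sum_v' fib v')%N.
  rewrite -sum1_card (partition_big f xpredT) //=; apply: eq_bigr => v' _.
  by rewrite /fib -sum1_card; apply: eq_bigl => w; rewrite inE.
by apply: leq_sum => v' _; apply: vmax.
Qed.

Section FixedScale.
Variables (R : realType) (d : nat) (A AO B : finType) (X : set (config d A))
  (O : set (config d AO)) (L : set (zlattice d)) (p : 'I_d -> zlattice d)
  (n : nat) (alpha gam eps : R) (m : 'I_d -> nat) (M : nat).
Hypotheses (d0 : (0 < d)%N) (X_shift : forall t x, X x -> X (Defs.shift t x))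
  (X0 : X !=set0) (orbitO : finite_orbit O) (XO : factors_onto X O)
  (latO : associated_lattice O L) (latL : lattice L) (basisL : lattice_basis L p).

Let D := outer_boundary (n%:R : R) (integer_points (fundamental_domain R p)).
Let bd : R := #|` fset_set D|%fset%:R.
Let vl : R := (vol L)%:R.
Let kappa : R := log_complexity R X (box (const_mx 1) m) / (\prod_i m i)%:R.

(* The share eps of the tile covers the points near its boundary, the letters
   spent on the frame, and the factor 4 lost between the mean number of
   surviving words and the number guaranteed. *)
Hypotheses (n0 : (0 < n)%N) (m_bounds : forall i, (0 < m i <= M)%N) (Mn : (M <= n)%N)
  (halpha : 0 < alpha <= 1) (gam1 : 1 < gam) (hbeta : alpha * #|B|%:R = gam ^+ 4)
  (heps : 0 < eps <= 1) (thin_boundary : bd < eps * vl)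
  (vl_gam : vl ^+ 2 <= gam ^+ n) (gam_large : 8 * expR 1 <= gam ^+ n)
  (n_large : ln 4 <= eps * n%:R)
  (room : eps * (kappa + ln #|B|%:R + 1) <= ln (alpha * #|B|%:R) - kappa).

Let g0 : 0 < gam. Proof. exact: lt_trans gam1. Qed.

Let a0 : 0 < alpha. Proof. by case/andP: halpha. Qed.

Let B0 : (0 < #|B|)%N.
Proof.
rewrite lt0n; apply: contraTneq (exprn_gt0 4 g0) => B0.
by rewrite -hbeta B0 mulr0 ltxx.
Qed.

Let nd : (n <= n ^ d)%N.
Proof. by rewrite -[X in (X <= _)%N]expn1 leq_pexp2l. Qed.

Let gam_le_B k : gam ^+ (4 * k) <= #|B|%:R ^+ k.
Proof.
rewrite exprM -hbeta lerXn2r ?nnegrE ?mulr_ge0 ?(ltW a0)//.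
by rewrite ler_piMl//; case/andP: halpha.
Qed.

(** Unless too few aperiodic words survive, which is rare, at least
[(alpha * #|B|) ^ vol L / 4] of them do. The frame has few points, so one
of its fillings has enough extensions among the survivors to code all the
patterns of [X] on the tile, whose number is controlled by [kappa]. *)
Lemma embedding_probability :
  1 - gam ^- (n ^ d) <=
  random_prob alpha [set F : {set pattern d n B} | embeds X (random_sft F)].
Proof.
have double_of_rest (x g e : nat) :
  (2 * e <= x -> x <= g + e -> x <= 2 * g)%N by lia.
have le_of_room (l k c e g v f : R) :
  l <= k -> g <= c + e -> v - f <= g -> k + e + f <= v -> l <= c by lra.
have half_mean (x y g : R) : 0 <= x -> y <= 2 * g -> x * y / 4 <= g * x / 2.
  by move=> x0 /(ler_wpM2l x0); lra.
(* v is the size of the tile, b that of its boundary, k the bound on the entropy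
   per point, l the logarithm of the number of letters, and h that of beta. *)
have capacity (v b k l c h N : R) : 0 <= v -> 0 <= k -> 0 <= l -> 0 < eps ->
    b <= eps * v -> c <= eps * N -> N <= v -> eps * (k + l + 1) <= h - k ->
    (v + b) * k + b * l + c <= v * h.
  move=> v0 k0 l0 e0 bv cN Nv hk.
  have := ler_wpM2r k0 bv; have := ler_wpM2r l0 bv.
  by have := ler_wpM2l (ltW e0) Nv; have := ler_wpM2l v0 hk; lra.
have [eps0 eps1] : 0 < eps /\ eps <= 1 by case/andP: heps.
have LB q q' : L q -> L q' -> L (q - q') by case: latL => _ + _; apply.
have [T [r [TP rP cardT]]] := fundamental_tiling R latL basisL.
have DE : D = outer_boundary (n%:R : R) [set` T] by rewrite TP.
have finD : finite_set D by rewrite DE; apply: finite_outer_boundary.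
have frame_le : (#|frame T n|%:R : R) <= bd.
  by rewrite ler_nat DE (card_frame_le _ _ LB rP).
have vlE : vl = #|{: T}|%:R by rewrite cardT.
have some_inner : ~~ [forall t, t \in frame T n].
  apply: contraTN thin_boundary => /forallP all_frame; rewrite -leNgt.
  apply: le_trans frame_le; apply: (@le_trans _ _ vl); first by rewrite ler_piMl.
  rewrite vlE ler_nat subset_leq_card//.
  by apply/fintype.subsetP => t _; apply: all_frame.
have sep := sparse_lattice LB rP some_inner.
have add_inj := translate_inj LB rP sep.
pose add := @translate d T r n.
have ndT : (n ^ d <= #|{: T}|)%N.
  by rewrite -(card_cube d n) (leq_card _ (add_inj (r 0))).
have gn1 : 1 <= gam ^+ n by rewrite exprn_ege1 ?ltW.
pose G := aperiodic_words B add.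
have half : (#|B| ^ #|{: T}| <= 2 * #|G|)%N.
  have := card_aperiodic_words (@card_common_window _ _ _ _ LB rP _ sep B).
  suff : (2 * (#|{: T}| ^ 2 * #|B| ^ (#|{: T}| - n ^ d)) <= #|B| ^ #|{: T}|)%N.
    by move=> small large; apply: double_of_rest small large.
  rewrite mulnA -[X in (_ <= _ ^ X)%N](subnKC ndT) expnD leq_mul2r; apply/orP; right.
  rewrite -(ler_nat R) natrM !natrX -vlE.
  apply: (@le_trans _ _ (#|B|%:R ^+ n)); last by rewrite ler_weXn2l// ler1n.
  apply: le_trans (gam_le_B n); rewrite [(4 * n)%N]mulnC exprM.
  have e1 : 1 <= expR 1 :> R by apply: le_trans (expR_ge1Dx 1); rewrite lerDl.
  have g2 : 2 <= gam ^+ n.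
    by apply: le_trans gam_large; rewrite -[leLHS]mulr1 ler_pM ?ler_nat.
  apply: (@le_trans _ _ ((gam ^+ n) ^+ 2)).
    by have := vl_gam; nra.
  by rewrite ler_weXn2l.
pose good (F : {set pattern d n B}) := [set w in G | F :&: windows add w == finset.set0].
pose bad F := (#|good F|%:R : R) < #|G|%:R * alpha ^+ #|{: T}| / 2.
have bad_rare : \sum_(F | bad F) bernoulli_weight alpha F <= gam ^- (n ^ d).
  have cover K := translate_thin_cover LB rP sep K d0 n0.
  have := few_surviving_words_rare add_inj halpha (ltW gam1) hbeta cover B0 half.
  move/le_trans; apply; rewrite card_cube -vlE.
  have : (1 + vl * gam ^- n) ^+ #|{: T}| <= expR 1.
    apply: (@le_trans _ _ (expR (vl * gam ^- n) ^+ #|{: T}|)).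
      by rewrite lerXn2r ?nnegrE ?expR_ge0 ?expR_ge1Dx// addr_ge0// mulr_ge0 // invr_ge0 ltW// exprn_gt0.
    rewrite -expRM_natl ler_expR -vlE mulrA -expr2.
    by rewrite ler_pdivrMr ?exprn_gt0// mul1r.
  move=> e; apply: (@le_trans _ _ (8 * gam ^- (2 * n ^ d) * expR 1)).
    by rewrite ler_wpM2l// mulr_ge0// invr_ge0 ltW// exprn_gt0.
  rewrite mulrAC ler_pdivrMr ?exprn_gt0// mulnC exprM expr2 mulrA mulVf ?mul1r.
    by apply: le_trans gam_large _; rewrite ler_weXn2l// ltW.
  by rewrite gt_eqF// exprn_gt0.
have good_embeds F : ~~ bad F -> embeds X (random_sft F).
  rewrite -leNgt => many.
  pose res (w : {ffun T -> B}) : {ffun {t : T | t \in frame T n} -> B} :=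
    [ffun t => w (val t)].
  have cardV : #|{ffun {t : T | t \in frame T n} -> B}| = (#|B| ^ #|frame T n|)%N.
    by rewrite card_ffun card_sig.
  have V0 : (0 < #|{ffun {t : T | t \in frame T n} -> B}|)%N.
    by rewrite cardV expn_gt0 B0.
  have [b bP] := large_fiber res (good F) V0.
  set C := [set w in good F | res w == b] in bP.
  have inC w : w \in C -> [/\ w \in G, F :&: windows add w = finset.set0 & res w = b].
    by rewrite !inE => /andP[/andP[wG /eqP FW] /eqP wb]; split; rewrite // inE.
  have [finO [z Oz]] := orbitO; have [pi piP _] := XO.
  apply: (tile_coding X_shift X0 finO Oz piP latO LB rP (C := C) d0 n0).
  - by move=> w /inC[].
  - move=> w q /inC[_ FW _]; apply/negP => qF.
    have : window add w q \in F :&: windows add w by rewrite inE qF imset_f.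
    by rewrite FW inE.
  - move=> w w' /inC[_ _ wb] /inC[_ _ w'b] t tF.
    have := congr1 (fun f : {ffun {t : T | t \in frame T n} -> B} => f (exist _ t tF))
      (etrans wb (esym w'b)).
    by rewrite !ffunE.
  have good_ge : (alpha * #|B|%:R) ^+ #|{: T}| / 4 <= #|good F|%:R.
    apply: le_trans many; rewrite exprMn.
    have : (#|B|%:R ^+ #|{: T}| : R) <= 2 * #|G|%:R by rewrite -natrX -natrM ler_nat.
    by apply: half_mean; rewrite exprn_ge0 // ltW.
  have ab0 : 0 < alpha * #|B|%:R by rewrite hbeta exprn_gt0.
  have good0 : 0 < (#|good F|%:R : R).
    by apply: lt_le_trans good_ge; rewrite divr_gt0// exprn_gt0.
  have C0 : (0 < #|C|)%N.
    have := good0; rewrite ltr0n => /leq_trans/(_ bP).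
    by rewrite muln_gt0 => /andP[].
  have ln_good : vl * ln (alpha * #|B|%:R) - ln 4 <= ln #|good F|%:R.
    apply: (@le_trans _ _ (ln ((alpha * #|B|%:R) ^+ #|{: T}| / 4))).
      by rewrite vlE mulr_natl ln_div ?posrE ?exprn_gt0// lnXn.
    by rewrite ler_ln ?posrE// divr_gt0// exprn_gt0.
  have ln_C : ln #|good F|%:R <= ln #|C|%:R + bd * ln #|B|%:R :> R.
    apply: (@le_trans _ _ (ln (#|C|%:R * #|B|%:R ^+ #|frame T n|))).
      rewrite ler_ln ?posrE// ?mulr_gt0 ?exprn_gt0 ?ltr0n//.
      by rewrite -natrX -natrM ler_nat -cardV.
    rewrite lnM ?posrE ?exprn_gt0 ?ltr0n// lnXn ?ltr0n// lerD2l.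
    by rewrite -[leLHS]mulr_natl ler_wpM2r// ln_ge0// ler1n.
  have pm0 : 0 < (\prod_i m i)%:R :> R.
    by rewrite natr_prod prodr_gt0// => i _; rewrite ltr0n; case/andP: (m_bounds i).
  have ln_L : log_complexity R X T <= (vl + bd) * kappa.
    have near_T (t q : zlattice d) : t \in T ->
        (forall i, `|q ord0 i - t ord0 i| <= M%:Z) -> q \in (T `|` fset_set D)%fset.
      move=> tT qt; rewrite in_fsetU; have [//|qT] := boolP (q \in T).
      rewrite in_fset_set// inE DE; apply: outer_boundary_near tT _ => // i.
      by apply: le_trans (qt i) _; rewrite lez_nat.
    have := log_complexity_tiling R X0 (const_mx 1) m_bounds near_T.
    rewrite -ler_pdivlMl// => /le_trans; apply.
    rewrite mulrC -mulrA ler_wpM2r ?divr_ge0 ?log_complexity_ge0//.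
    rewrite vlE -natrD ler_nat -cardfE cardfsU; exact: leq_subr.
  have L0 : (0 < #|language T X|)%N.
    by have [x Xx] := X0; apply/card_gt0P; eexists; apply: (in_language T 0 Xx).
  rewrite -(ler_nat R) -ler_ln ?posrE ?ltr0n//.
  apply: le_of_room ln_L ln_C ln_good _.
  apply: (capacity _ _ _ _ _ _ n%:R) => //.
  - by rewrite divr_ge0 ?log_complexity_ge0.
  - by rewrite ln_ge0// ler1n.
  - exact: ltW.
  - by rewrite vlE ler_nat (leq_trans nd ndT).
rewrite lerBlDr -(random_prob_setT d n B alpha) /random_prob.
have pmfE F : random_pmf alpha F = bernoulli_weight alpha F.
  by rewrite /random_pmf /bernoulli_weight card_pattern.
rewrite (bigID bad) /= addrC; apply: lerD; last first.
  rewrite (eq_bigl bad) => [|F]; last by rewrite in_setT.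
  by under eq_bigr do rewrite pmfE.
rewrite big_mkcond [leRHS]big_mkcond; apply: ler_sum => F _; rewrite in_setT /= pmfE.
have w0 := bernoulli_weight_ge0 halpha F.
case: ifPn => [/good_embeds eF|_]; last by case: ifP.
by rewrite ifT// inE.
Qed.

End FixedScale.

Local Open Scope ring_scope.

(** * All large scales *)

Theorem theorem1p12 (R : realType) (d : nat) (hd : (1 <= d)%N)
    (A : finType) (X : set (config d A)) (hX : subshift X)
    (hmarker : periodic_marker R X (fun n => n))
    (AY : finType) (alphaY : R) (halpha : 0 <= alphaY <= 1)
    (hent : (entropy R X < lne (alphaY * #|AY|%:R)%:E)%E) :
  exists2 rho : R, 0 < rho &
    \forall n \near \oo,
      1 - expR (- rho * (n ^ d)%:R) <=
      random_prob alphaY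
        [set F : {set pattern d n AY} | embeds X (random_sft F)].
Proof.
have [_ X_shift] := hX.
have [AO [Orb [L [orbO XO latO [_ latL [p basisL [vol_growth boundary_small]]]]]]] := hmarker.
have X0 : X !=set0.
  have [_ [z Oz]] := orbO 0%N; have [pi _ surj] := XO 0%N.
  have /surj[x Xx _] : Orb 0%N z.
    by rewrite Oz; exists 0 => //; apply/funext => s; rewrite /Defs.shift addr0.
  by exists x.
have beta0 : 0 < alphaY * #|AY|%:R.
  by rewrite ltNge; apply/negP => b0; move: hent; rewrite le0_lneNy ?lee_fin// ltNge leNye.
rewrite lne_EFin// in hent.
have [m m0 box_small] := entropy_lt_box X0 hent.
set kappa := log_complexity R X (box (const_mx 1) m) / (\prod_i m i)%:R.
set beta := alphaY * _ in beta0 hent box_small *.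
have pm0 : 0 < (\prod_i m i)%:R :> R.
  by rewrite natr_prod prodr_gt0// => i _; rewrite ltr0n.
have kappa0 : 0 <= kappa by rewrite divr_ge0 ?log_complexity_ge0.
have kappa_lt : kappa < ln beta by rewrite ltr_pdivrMr// mulrC.
have a0 : 0 < alphaY.
  have /andP[a0 _] := halpha; rewrite lt_neqAle a0 andbT eq_sym.
  by apply: contraTneq beta0 => a00; rewrite /beta a00 mul0r ltxx.
have AY0 : (0 < #|AY|)%N.
  by rewrite lt0n; apply: contraTneq beta0 => AY0; rewrite /beta AY0 mulr0 ltxx.
(* The probability bound uses half of the gain in gam ^- (2 * n ^ d), where
   gam ^+ 4 = beta; the other half absorbs the constants. *)
pose rho := ln beta / 4; pose gam := expR rho.
have rho0 : 0 < rho by rewrite divr_gt0// (le_lt_trans kappa0).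
have gam1 : 1 < gam by rewrite expR_gt1.
have gam4 : beta = gam ^+ 4.
  by rewrite -expRM_natl mulrC divfK// lnK// posrE.
(* With this eps, eps * s is at most the gap ln beta - kappa, and eps <= 1. *)
pose s := kappa + ln #|AY|%:R + 1; pose eps := (ln beta - kappa) / (s + (ln beta - kappa)).
have s0 : 0 < s by rewrite ltr_wpDl// addr_ge0// ln_ge0// ler1n.
have gap0 : 0 < ln beta - kappa by rewrite subr_gt0.
have total0 : 0 < s + (ln beta - kappa) by apply: addr_gt0.
have eps0 : 0 < eps by exact: divr_gt0.
have eps1 : eps <= 1 by rewrite /eps ler_pdivrMr// mul1r lerDr ltW.
have room : eps * s <= ln beta - kappa.
  rewrite /eps mulrAC ler_pdivrMr// ler_wpM2l ?(ltW gap0)//.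
  by rewrite lerDl ltW.
exists rho => //.
have logv : \forall n \near \oo, n%:R^-1 * ln (vol (L n))%:R < rho / 2 :> R.
  by apply: (cvgr_lt _ vol_growth); rewrite divr_gt0.
have thin : \forall n \near \oo, #|` fset_set (outer_boundary (n%:R : R)
      (integer_points (fundamental_domain R (p n))))|%fset%:R / (vol (L n))%:R < eps :> R.
  exact: (cvgr_lt _ boundary_small).
near=> n.
have n0 : (0 < n)%N by near: n; exists 1%N.
have nR : 0 < n%:R :> R by rewrite ltr0n.
have vol0 : 0 < (vol (L n))%:R :> R.
  have [L0 _ finC] := latL n; rewrite ltr0n cardfs_gt0; apply/fset0Pn.
  by exists [set q | L n (q - 0)]; rewrite in_fset_set// inE; exists 0.
have -> : expR (- rho * (n ^ d)%:R) = gam ^- (n ^ d).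
  by rewrite mulNr expRN mulrC expRM_natl.
apply: (@embedding_probability R d A (AO n) AY X (Orb n) (L n) (p n) n alphaY gam eps
  m (\max_i m i)%N) => //.
- by move=> i; rewrite m0 leq_bigmax.
- by near: n; exists (\max_i m i)%N.
- by rewrite a0; case/andP: halpha.
- by rewrite eps0.
- by rewrite -ltr_pdivrMr//; near: n.
- have : n%:R^-1 * ln (vol (L n))%:R < rho / 2 by near: n.
  rewrite ltr_pdivrMl// => lt; rewrite -expRM_natl -[leLHS]lnK ?posrE ?exprn_gt0//.
  by rewrite ler_expR lnXn// -[leLHS]mulr_natl; lra.
- rewrite -expRM_natl; near: n; apply: filterS (nbhs_infty_ger (ln (8 * expR 1) / rho)) => n.
  rewrite ler_pdivrMr// => le; rewrite -[leLHS]lnK ?posrE ?mulr_gt0 ?expR_gt0//.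
  by rewrite ler_expR.
- near: n; apply: filterS (nbhs_infty_ger (ln 4 / eps)) => n.
  by rewrite ler_pdivrMr// mulrC.
Unshelve. all: by end_near. Qed.
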